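(* Let $(A,\cdot,\{,\},d)$ be any differential graded Poisson algebra over a field $\Bbbk$. Then $A^e\cong A^E$ as differential graded algebras, where $A^e$ is the differential graded algebra presented by generators $m_a,h_a$ ($a\in A$) and $A^E$ is the quotient of the smash product $A\#\mathbf{U}(A)$, both as constructed in the context.
   Context: Everything is over a field $\Bbbk$; all algebras have an identity and maps of algebras preserve it; $|x|$ is the degree of a homogeneous element $x$. A differential graded (DG) algebra is a $\mathbb{Z}$-graded algebra with a linear map $d$ of degree $1$ with $d^2=0$ and $d(ab)=d(a)b+(-1)^{|a|}a\,d(b)$ for homogeneous $a,b$. DG algebra maps are graded algebra maps of degree $0$ commuting with differentials. A DG Lie algebra $(L,\{,\},d)$ is a $\mathbb{Z}$-graded vector space with a degree $0$ bracket satisfying $\{a,b\}=-(-1)^{|a||b|}\{b,a\}$ and $\{a,\{b,c\}\}=\{\{a,b\},c\}+(-1)^{|a||b|}\{b,\{a,c\}\}$, and a degree $1$ linear map $d$ with $d^2=0$, $d(\{a,b\})=\{d(a),b\}+(-1)^{|a|}\{a,d(b)\}$. A DG Poisson algebra $(A,\cdot,\{,\},d)$ is a DG algebra $(A,\cdot,d)$ that is graded commutative, $ab=(-1)^{|a||b|}ba$, such that $(A,\{,\},d)$ is a DG Lie algebra and $\{a,bc\}=\{a,b\}c+(-1)^{|a||b|}b\{a,c\}$ for homogeneous $a,b,c$. Construction of $A^e$: let $m_A=\{m_a\mid a\in A\}$ and $h_A=\{h_a\mid a\in A\}$ be two copies of the graded vector space $A$ (via linear isomorphisms $a\mapsto m_a$,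 $a\mapsto h_a$), with $|m_a|=|h_a|=|a|$. $A^e$ is the $\mathbb{Z}$-graded algebra generated by $m_A$ and $h_A$ subject to, for all homogeneous $a,b\in A$: $m_{ab}=m_am_b$; $h_{ab}=m_ah_b+(-1)^{|a||b|}m_bh_a$; $m_{\{a,b\}}=h_am_b-(-1)^{|a||b|}m_bh_a$; $h_{\{a,b\}}=h_ah_b-(-1)^{|a||b|}h_bh_a$; $m_1=1$. Its differential $\partial$ is the degree $1$ map determined by $\partial(m_a)=m_{d(a)}$, $\partial(h_a)=h_{d(a)}$ and $\partial(xy)=\partial(x)y+(-1)^{|x|}x\partial(y)$. Construction of $A^E$: let $\mathbf{U}(A)=T(A)/(g\otimes h-(-1)^{|g||h|}h\otimes g-\{g,h\})$ ($g,h\in A$ homogeneous) be the universal enveloping algebra of the DG Lie algebra $(A,\{,\},d)$, a DG Hopf algebra with differential extending $d$ and comultiplication $\Delta(h)=h\otimes1+1\otimes h$ for $h\in\mathbb{A}$, where $\mathbb{A}$ denotes the image of $A$ in $\mathbf{U}(A)$. $\mathbf{U}(A)$ acts on $A$ from the left by $1\cdot a=a$ and $h\cdot a=\{h,a\}$ for $h\in\mathbb{A}$. The smash product $A\#\mathbf{U}(A)$ is $A\otimes\mathbf{U}(A)$ as a vector space, with product $(a\#g)(b\#h)=\sum_{(g)}(-1)^{|g_2||b|}a(g_1\cdot b)\#(g_2h)$ (Sweedler notation $\Delta(g)=\sum g_1\otimes g_2$) and differential $d(a\#h)=d_A(a)\#h+(-1)^{|a|}a\#d_{\mathbf{U}(A)}(h)$.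 Then $A^E=A\#\mathbf{U}(A)/I$, where $I$ is the two-sided ideal generated by the elements $1\#(ab)-a\#b-(-1)^{|a||b|}b\#a$ for homogeneous $a,b\in A$ (where an element of $A$ written to the right of $\#$ denotes its image in $\mathbb{A}\subseteq\mathbf{U}(A)$, and $ab$ is the product in $A$), with the induced differential. *)

(* Defs.v *)
From HB Require Import structures.
From mathcomp Require Import all_boot ssrAC all_order all_algebra.
From mathcomp Require Import boolp.
From mathcomp Require Import ring.

Set Implicit Arguments.
Unset Strict Implicit.
Unset Printing Implicit Defensive.

Import GRing.Theory.
Local Open Scope ring_scope.

(* A Z-graded vector space is a family V : int -> lmodType k;
   only homogeneous elements appear, the degree |x| of x : V i being i.  A
   product of elements of degrees i and j takes an equation i + j = n as an
   argument and lands in degree n; this replaces transport along equalities in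
   int.  All laws are stated for arbitrary such equations.  Algebras may be zero. *)

(* A carrier with module operations satisfying the module laws up to a
   congruence.  Its quotient is a k-module; tensor products, tensor algebras
   and quotients by ideals are all built in this way. *)
Record preLmod (k : fieldType) := PreLmod {
  pm_sort : Type;
  pm_eq : pm_sort -> pm_sort -> Prop;
  pm_zero : pm_sort;
  pm_add : pm_sort -> pm_sort -> pm_sort;
  pm_opp : pm_sort -> pm_sort;
  pm_scale : k -> pm_sort -> pm_sort;
  pm_refl : forall x, pm_eq x x;
  pm_sym : forall x y, pm_eq x y -> pm_eq y x;
  pm_trans : forall x y z, pm_eq x y -> pm_eq y z -> pm_eq x z;
  pm_congD : forall x x' y y',
    pm_eq x x' -> pm_eq y y' -> pm_eq (pm_add x y) (pm_add x' y');
  pm_congN : forall x x', pm_eq x x' -> pm_eq (pm_opp x) (pm_opp x');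
  pm_congZ : forall c x x', pm_eq x x' -> pm_eq (pm_scale c x) (pm_scale c x');
  pm_addA : forall x y z,
    pm_eq (pm_add x (pm_add y z)) (pm_add (pm_add x y) z);
  pm_addC : forall x y, pm_eq (pm_add x y) (pm_add y x);
  pm_add0 : forall x, pm_eq (pm_add pm_zero x) x;
  pm_addN : forall x, pm_eq (pm_add (pm_opp x) x) pm_zero;
  pm_scaleA : forall a b x,
    pm_eq (pm_scale a (pm_scale b x)) (pm_scale (a * b) x);
  pm_scale1 : forall x, pm_eq (pm_scale 1 x) x;
  pm_scaleDr : forall a x y,
    pm_eq (pm_scale a (pm_add x y)) (pm_add (pm_scale a x) (pm_scale a y));
  pm_scaleDl : forall a b x,
    pm_eq (pm_scale (a + b) x) (pm_add (pm_scale a x) (pm_scale b x))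
}.

Section Quo.
Context (k : fieldType) (M : preLmod k).
Local Open Scope quotient_scope.

Definition pm_rel : rel {classic pm_sort M} := fun x y => `[< pm_eq x y >].

Lemma pm_rel_refl : reflexive pm_rel.
Proof. by move=> x; apply/asboolP; apply: pm_refl. Qed.
Lemma pm_rel_sym : symmetric pm_rel.
Proof. by move=> x y; apply/asboolP/asboolP; apply: pm_sym. Qed.
Lemma pm_rel_trans : transitive pm_rel.
Proof.
by move=> y x z /asboolP xy /asboolP yz; apply/asboolP; apply: pm_trans xy yz.
Qed.

Canonical pm_equiv := EquivRel pm_rel pm_rel_refl pm_rel_sym pm_rel_trans.

Definition quo : Type := {eq_quot pm_equiv}.
HB.instance Definition _ := Choice.on quo.

Definition qpi (x : pm_sort M) : quo := \pi_({eq_quot pm_equiv}) (x : {classic _}).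
Definition qrepr (x : quo) : pm_sort M := repr (x : {eq_quot pm_equiv}).

Lemma qreprK x : qpi (qrepr x) = x.
Proof. exact: reprK. Qed.

Lemma qpiP x y : qpi x = qpi y <-> pm_eq x y.
Proof.
split=> [/eqmodP|] H; first by apply/asboolP.
by apply/eqmodP; apply/asboolP.
Qed.

Lemma qreprP x : pm_eq (qrepr (qpi x)) x.
Proof. by apply/qpiP; rewrite qreprK. Qed.

Definition quo_add (x y : quo) := qpi (pm_add (qrepr x) (qrepr y)).
Definition quo_opp (x : quo) := qpi (pm_opp (qrepr x)).
Definition quo_scale (c : k) (x : quo) := qpi (pm_scale c (qrepr x)).

Lemma quo_addE x y : quo_add (qpi x) (qpi y) = qpi (pm_add x y).
Proof. by apply/qpiP/pm_congD; apply: qreprP. Qed.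
Lemma quo_oppE x : quo_opp (qpi x) = qpi (pm_opp x).
Proof. by apply/qpiP/pm_congN; apply: qreprP. Qed.
Lemma quo_scaleE c x : quo_scale c (qpi x) = qpi (pm_scale c x).
Proof. by apply/qpiP/pm_congZ; apply: qreprP. Qed.
Let E := (quo_addE, quo_oppE, quo_scaleE).

Lemma quo_ind (P : quo -> Prop) : (forall x, P (qpi x)) -> forall x, P x.
Proof. by move=> H x; rewrite -(qreprK x). Qed.

Lemma quo_addA : associative quo_add.
Proof.
elim/quo_ind=> x; elim/quo_ind=> y; elim/quo_ind=> z.
by rewrite !E; apply/qpiP/pm_addA.
Qed.
Lemma quo_addC : commutative quo_add.
Proof. by elim/quo_ind=> x; elim/quo_ind=> y; rewrite !E; apply/qpiP/pm_addC. Qed.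
Lemma quo_add0 : left_id (qpi (pm_zero M)) quo_add.
Proof. by elim/quo_ind=> x; rewrite !E; apply/qpiP/pm_add0. Qed.
Lemma quo_addN : left_inverse (qpi (pm_zero M)) quo_opp quo_add.
Proof. by elim/quo_ind=> x; rewrite !E; apply/qpiP/pm_addN. Qed.
HB.instance Definition _ :=
  GRing.isZmodule.Build quo quo_addA quo_addC quo_add0 quo_addN.

Lemma quo_scaleA a b (v : quo) : quo_scale a (quo_scale b v) = quo_scale (a * b) v.
Proof. by elim/quo_ind: v => x; rewrite !E; apply/qpiP/pm_scaleA. Qed.
Lemma quo_scale1 : left_id 1 quo_scale.
Proof. by elim/quo_ind=> x; rewrite !E; apply/qpiP/pm_scale1. Qed.
Lemma quo_scaleDr : right_distributive quo_scale +%R.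
Proof.
by move=> a; elim/quo_ind=> x; elim/quo_ind=> y; rewrite /GRing.add /= !E; apply/qpiP/pm_scaleDr.
Qed.
Lemma quo_scaleDl (v : quo) : {morph quo_scale^~ v : a b / a + b}.
Proof.
by elim/quo_ind: v => x a b; rewrite [RHS]/GRing.add /= !E; apply/qpiP/pm_scaleDl.
Qed.
HB.instance Definition _ :=
  GRing.Zmodule_isLmodule.Build k quo quo_scaleA quo_scale1 quo_scaleDr quo_scaleDl.

Lemma qpi0 : qpi (pm_zero M) = 0. Proof. by []. Qed.
Lemma qpiD x y : qpi (pm_add x y) = qpi x + qpi y.
Proof. by rewrite -quo_addE. Qed.
Lemma qpiN x : qpi (pm_opp x) = - qpi x.
Proof. by rewrite -quo_oppE. Qed.
Lemma qpiZ c x : qpi (pm_scale c x) = c *: qpi x.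
Proof. by rewrite -quo_scaleE. Qed.
End Quo.

Local Obligation Tactic := intros.
Section LinearFacts.
Context (k : fieldType) (U V : lmodType k) (f : U -> V).
Hypothesis fL : linear f.
Lemma lin0 : f 0 = 0.
Proof.
have := fL (-1) 0 0; rewrite !scaler0 !addr0 => /eqP.
by rewrite scaleN1r addNr => /eqP.
Qed.
Lemma linD x y : f (x + y) = f x + f y.
Proof. by have := fL 1 x y; rewrite !scale1r. Qed.
Lemma linZ c x : f (c *: x) = c *: f x.
Proof. by have := fL c x 0; rewrite lin0 !addr0. Qed.
Lemma linN x : f (- x) = - f x.
Proof. by rewrite -scaleN1r linZ scaleN1r. Qed.
Lemma linB x y : f (x - y) = f x - f y.
Proof. by rewrite linD linN. Qed.
End LinearFacts.

Section Sign.
Context (k : fieldType).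
(* sgn k x = (-1)^x in k *)
Definition sgn (x : int) : k := (-1) ^ x.
Lemma sgnD x y : sgn (x + y) = sgn x * sgn y.
Proof. by rewrite /sgn expfzDr // oppr_eq0 oner_eq0. Qed.
Lemma sgn0 : sgn 0 = 1. Proof. by []. Qed.
Lemma sgn1 : sgn 1 = -1. Proof. by []. Qed.
Lemma sgn_sq x : sgn x * sgn x = 1.
Proof.
by rewrite /sgn -expfzMl mulrNN mulr1 exp1rz.
Qed.
Lemma sgn_mod z x y : x = y + (z + z) -> sgn x = sgn y.
Proof. by move->; rewrite sgnD [sgn (z + z)]sgnD sgn_sq mulr1. Qed.
Lemma sgnMDl1 x y : sgn ((x + 1) * y) = sgn (x * y) * sgn y.
Proof. by rewrite mulrDl mul1r sgnD. Qed.
Lemma sgnMDr1 x y : sgn (x * (y + 1)) = sgn (x * y) * sgn x.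
Proof. by rewrite mulrDr mulr1 sgnD. Qed.
End Sign.

Definition gspace (k : fieldType) := int -> lmodType k.

Section Het.
Context (k : fieldType) (V : gspace k).
(* Equality of elements of possibly different degrees. *)
Definition heq i j (x : V i) (y : V j) : Prop :=
  existT (fun n => V n : Type) i x = existT (fun n => V n : Type) j y.
Lemma heqP i (x y : V i) : heq x y -> x = y.
Proof. exact: (Eqdep_dec.inj_pair2_eq_dec _ (fun a b => decP eqP)). Qed.
Lemma heq_refl i (x : V i) : heq x x. Proof. by []. Qed.
End Het.

(* A family of maps of degree 1. *)
Definition gdiff (k : fieldType) (V : gspace k) :=
  forall i j : int, i + 1 = j -> V i -> V j.

Record is_diff (k : fieldType) (V : gspace k) (d : gdiff V) : Prop := IsDiff {
  diff_lin : forall i j (e : i + 1 = j), linear (d i j e);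
  diff_sq : forall i j n (e : i + 1 = j) (e' : j + 1 = n) (x : V i),
    d j n e' (d i j e x) = 0
}.

Record gAlg (k : fieldType) := GAlg {
  ga_sp :> int -> lmodType k;
  gmul : forall i j n : int, i + j = n -> ga_sp i -> ga_sp j -> ga_sp n;
  gone : ga_sp 0;
  gmul_linl : forall i j n (e : i + j = n) (y : ga_sp j), linear ((gmul e)^~ y);
  gmul_linr : forall i j n (e : i + j = n) (x : ga_sp i), linear (gmul e x);
  gmulA : forall i j l ij jl n (p : i + j = ij) (q : ij + l = n)
      (r : j + l = jl) (s : i + jl = n) (x : ga_sp i) (y : ga_sp j) (z : ga_sp l),
    gmul q (gmul p x y) z = gmul s x (gmul r y z);
  gmul1l : forall i (e : 0 + i = i) (x : ga_sp i), gmul e gone x = x;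
  gmul1r : forall i (e : i + 0 = i) (x : ga_sp i), gmul e x gone = x
}.
Arguments gmul {k} B {i j n} e x y : rename, simpl never.
Arguments gone {k} B : rename, simpl never.

Definition leibniz (k : fieldType) (A : gAlg k) (d : gdiff A) : Prop :=
  forall i j n i' j' n' (e : i + j = n) (ei : i + 1 = i') (ej : j + 1 = j')
    (en : n + 1 = n') (el : i' + j = n') (er : i + j' = n') (x : A i) (y : A j),
  d _ _ en (gmul A e x y) =
    gmul A el (d _ _ ei x) y + sgn k i *: gmul A er x (d _ _ ej y).

Record dgAlg (k : fieldType) := DGAlg {
  dga_alg :> gAlg k;
  dga_d : gdiff dga_alg;
  dga_diff : is_diff dga_d;
  dga_leibniz : leibniz dga_d
}.
Arguments dga_d {k} B {i j} e x : rename, simpl never.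

Record gHom (k : fieldType) (A B : gAlg k) := GHom {
  gh_fun :> forall n, A n -> B n;
  gh_lin : forall n, linear (@gh_fun n);
  gh_mul : forall i j n (e : i + j = n) (x : A i) (y : A j),
    gh_fun (gmul A e x y) = gmul B e (gh_fun x) (gh_fun y);
  gh_one : gh_fun (gone A) = gone B
}.

Record dgHom (k : fieldType) (A B : dgAlg k) := DGHom {
  dgh_hom :> gHom A B;
  dgh_d : forall i j (e : i + 1 = j) (x : A i),
    dgh_hom j (dga_d A e x) = dga_d B e (dgh_hom i x)
}.

Definition dg_isomorphic (k : fieldType) (A B : dgAlg k) : Prop :=
  exists f : dgHom A B, forall n, bijective (f n).

Section GAlgFacts.
Context (k : fieldType) (A : gAlg k).
Section S.
Variables (i j n : int) (e : i + j = n).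
Lemma gmulDl (x x' : A i) (y : A j) : gmul A e (x + x') y = gmul A e x y + gmul A e x' y.
Proof. exact: (linD (gmul_linl e y)). Qed.
Lemma gmulDr (x : A i) (y y' : A j) : gmul A e x (y + y') = gmul A e x y + gmul A e x y'.
Proof. exact: (linD (gmul_linr e x)). Qed.
Lemma gmulZl c (x : A i) (y : A j) : gmul A e (c *: x) y = c *: gmul A e x y.
Proof. exact: (linZ (gmul_linl e y)). Qed.
Lemma gmulZr c (x : A i) (y : A j) : gmul A e x (c *: y) = c *: gmul A e x y.
Proof. exact: (linZ (gmul_linr e x)). Qed.
Lemma gmulNl (x : A i) (y : A j) : gmul A e (- x) y = - gmul A e x y.
Proof. exact: (linN (gmul_linl e y)). Qed.
Lemma gmulNr (x : A i) (y : A j) : gmul A e x (- y) = - gmul A e x y.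
Proof. exact: (linN (gmul_linr e x)). Qed.
Lemma gmulBl (x x' : A i) (y : A j) : gmul A e (x - x') y = gmul A e x y - gmul A e x' y.
Proof. by rewrite gmulDl gmulNl. Qed.
Lemma gmulBr (x : A i) (y y' : A j) : gmul A e x (y - y') = gmul A e x y - gmul A e x y'.
Proof. by rewrite gmulDr gmulNr. Qed.
Lemma gmul0l (y : A j) : gmul A e 0 y = 0.
Proof. exact: (lin0 (gmul_linl e y)). Qed.
Lemma gmul0r (x : A i) : gmul A e x 0 = 0.
Proof. exact: (lin0 (gmul_linr e x)). Qed.
End S.
Lemma gmul_e i j n (e e' : i + j = n) (x : A i) (y : A j) :
  gmul A e x y = gmul A e' x y.
Proof. by rewrite (eq_irrelevance e e'). Qed.
Lemma heq_mul i j n n' (e : i + j = n) (e' : i + j = n') (x : A i) (y : A j) :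
  heq (gmul A e x y) (gmul A e' x y).
Proof.
have nn : n = n' by rewrite -e -e'.
by destruct nn; rewrite (gmul_e e e').
Qed.
Lemma heq_mulA i j l ij jl n n' (p : i + j = ij) (q : ij + l = n)
      (r : j + l = jl) (s : i + jl = n') (x : A i) (y : A j) (z : A l) :
  heq (gmul A q (gmul A p x y) z) (gmul A s x (gmul A r y z)).
Proof.
have nn : n = n' by rewrite -q -s -p -r addrA.
by destruct nn; rewrite (gmulA p q r s).
Qed.
Lemma heq_mul1l i n (e : 0 + i = n) (x : A i) : heq (gmul A e (gone A) x) x.
Proof. by have ei : i = n by [rewrite -e add0r]; destruct ei; rewrite gmul1l. Qed.
Lemma heq_mul1r i n (e : i + 0 = n) (x : A i) : heq (gmul A e x (gone A)) x.
Proof. by have ei : i = n by [rewrite -e addr0]; destruct ei; rewrite gmul1r. Qed.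
End GAlgFacts.

Section GHomFacts.
Context (k : fieldType) (A B : gAlg k) (f : gHom A B) (n : int).
Lemma gh0 : f n 0 = 0. Proof. exact: lin0 (@gh_lin _ _ _ f n). Qed.
Lemma ghD x y : f n (x + y) = f n x + f n y. Proof. exact: linD (@gh_lin _ _ _ f n) _ _. Qed.
Lemma ghN x : f n (- x) = - f n x. Proof. exact: linN (@gh_lin _ _ _ f n) _. Qed.
Lemma ghB x y : f n (x - y) = f n x - f n y. Proof. exact: linB (@gh_lin _ _ _ f n) _ _. Qed.
Lemma ghZ c x : f n (c *: x) = c *: f n x. Proof. exact: linZ (@gh_lin _ _ _ f n) _ _. Qed.
End GHomFacts.

(* Two-sided homogeneous ideal generated by a family S of homogeneous elements,
   and the quotient graded algebra. *)
Section Ideal.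
Context (k : fieldType) (A : gAlg k).
Variable S : forall n, A n -> Prop.
Inductive ideal : forall n, A n -> Prop :=
| ideal_gen n (x : A n) : S x -> ideal x
| ideal0 n : ideal (0 : A n)
| idealD n (x y : A n) : ideal x -> ideal y -> ideal (x + y)
| idealZ n c (x : A n) : ideal x -> ideal (c *: x)
| idealMl i j n (e : i + j = n) (x : A i) (y : A j) : ideal y -> ideal (gmul A e x y)
| idealMr i j n (e : i + j = n) (x : A i) (y : A j) : ideal x -> ideal (gmul A e x y).

Lemma ideal_eq n (x y : A n) : ideal x -> y = x -> ideal y.
Proof. by move=> Hx ->. Qed.
Lemma idealN n (x : A n) : ideal x -> ideal (- x).
Proof. by rewrite -scaleN1r; apply: idealZ. Qed.
Lemma idealB n (x y : A n) : ideal x -> ideal y -> ideal (x - y).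
Proof. by move=> Hx Hy; apply/idealD/idealN. Qed.

Program Definition quo_pre n : preLmod k :=
  @PreLmod k (A n) (fun x y => ideal (x - y)) 0 +%R -%R *:%R _ _ _ _ _ _ _ _ _ _ _ _ _ _.
Next Obligation. by rewrite /= subrr; apply: ideal0. Qed.
Next Obligation. by rewrite /= -opprB; apply: idealN. Qed.
Next Obligation. by rewrite /= -(subrKA y); apply: idealD. Qed.
Next Obligation. by rewrite /= opprD addrACA; apply: idealD. Qed.
Next Obligation. by rewrite /= -opprD; apply: idealN. Qed.
Next Obligation. by rewrite /= -scalerBr; apply: idealZ. Qed.
Next Obligation. by rewrite /= addrA subrr; apply: ideal0. Qed.
Next Obligation. by rewrite /= [x + y]addrC subrr; apply: ideal0. Qed.
Next Obligation. by rewrite /= add0r subrr; apply: ideal0. Qed.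
Next Obligation. by rewrite /= addNr subrr; apply: ideal0. Qed.
Next Obligation. by rewrite /= scalerA subrr; apply: ideal0. Qed.
Next Obligation. by rewrite /= scale1r subrr; apply: ideal0. Qed.
Next Obligation. by rewrite /= scalerDr subrr; apply: ideal0. Qed.
Next Obligation. by rewrite /= scalerDl subrr; apply: ideal0. Qed.

Definition gquo_sp : gspace k := fun n => quo (quo_pre n).
Definition gpi n (x : A n) : gquo_sp n := @qpi k (quo_pre n) x.
Definition grepr n (x : gquo_sp n) : A n := qrepr x.

Lemma gpi_eq n (x y : A n) : gpi x = gpi y <-> ideal (x - y).
Proof. exact: qpiP. Qed.
Lemma gpi_eq0 n (x : A n) : gpi x = 0 <-> ideal x.
Proof. by rewrite -[0]/(gpi 0) gpi_eq subr0. Qed.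
Lemma gpi_ind n (P : gquo_sp n -> Prop) : (forall x, P (gpi x)) -> forall x, P x.
Proof. exact: (@quo_ind k _ P). Qed.
Lemma grepr_pi n (x : A n) : ideal (grepr (gpi x) - x).
Proof. exact: (@qreprP k (quo_pre n)). Qed.
Lemma gpi_lin n : linear (@gpi n).
Proof.
move=> c x y; rewrite /gpi -(@qpiZ k (quo_pre n)).
by rewrite -(@qpiD k (quo_pre n)).
Qed.

Definition gquo_mul i j n (e : i + j = n) (x : gquo_sp i) (y : gquo_sp j) : gquo_sp n :=
  gpi (gmul A e (grepr x) (grepr y)).
Lemma gquo_mulE i j n (e : i + j = n) (x : A i) (y : A j) :
  gquo_mul e (gpi x) (gpi y) = gpi (gmul A e x y).
Proof.
apply/gpi_eq.
rewrite -(subrKA (gmul A e (grepr (gpi x)) y)) -gmulBr -gmulBl.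
by apply: idealD; [apply: idealMl|apply: idealMr]; apply: grepr_pi.
Qed.
Program Definition gquo : gAlg k :=
  @GAlg k gquo_sp gquo_mul (gpi (gone A)) _ _ _ _ _.
Next Obligation.
elim/gpi_ind: y => y c; elim/gpi_ind => x; elim/gpi_ind => x'.
by rewrite -gpi_lin !gquo_mulE -gpi_lin gmulDl gmulZl.
Qed.
Next Obligation.
elim/gpi_ind: x => x c; elim/gpi_ind => y; elim/gpi_ind => y'.
by rewrite -gpi_lin !gquo_mulE -gpi_lin gmulDr gmulZr.
Qed.
Next Obligation.
elim/gpi_ind: x => x; elim/gpi_ind: y => y; elim/gpi_ind: z => z.
by rewrite !gquo_mulE (gmulA _ _ r s).
Qed.
Next Obligation. by elim/gpi_ind: x => x; rewrite gquo_mulE gmul1l. Qed.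
Next Obligation. by elim/gpi_ind: x => x; rewrite gquo_mulE gmul1r. Qed.

Lemma gpiM i j n (e : i + j = n) (x : A i) (y : A j) :
  gmul gquo e (gpi x) (gpi y) = gpi (gmul A e x y).
Proof. exact: gquo_mulE. Qed.

Program Definition gproj : gHom A gquo := @GHom k A gquo gpi _ _ _.
Next Obligation. exact: gpi_lin. Qed.
Next Obligation. by rewrite gpiM. Qed.
Next Obligation. by []. Qed.

Section Lift.
Variables (B : gAlg k) (f : gHom A B).
Hypothesis fS : forall n (x : A n), S x -> f n x = 0.
Lemma ideal_ker n (x : A n) : ideal x -> f n x = 0.
Proof.
elim=> {n x} //.
- by move=> n; rewrite gh0.
- by move=> n x y _ Hx _ Hy; rewrite ghD Hx Hy addr0.
- by move=> n c x _ Hx; rewrite ghZ Hx scaler0.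
- by move=> i j n e x y _ H; rewrite gh_mul H gmul0r.
- by move=> i j n e x y _ H; rewrite gh_mul H gmul0l.
Qed.
Definition gquo_lift_fun n (x : gquo n) : B n := f n (grepr x).
Lemma gquo_lift_funE n (x : A n) : gquo_lift_fun (gpi x) = f n x.
Proof. by apply/eqP; rewrite -subr_eq0 -ghB; apply/eqP/ideal_ker/grepr_pi. Qed.
Program Definition gquo_lift : gHom gquo B := @GHom k gquo B gquo_lift_fun _ _ _.
Next Obligation.
move=> c; elim/gpi_ind => x; elim/gpi_ind => y.
by rewrite -gpi_lin !gquo_lift_funE ghD ghZ.
Qed.
Next Obligation.
elim/gpi_ind: x => x; elim/gpi_ind: y => y.
by rewrite gpiM !gquo_lift_funE gh_mul.
Qed.
Next Obligation. by rewrite gquo_lift_funE gh_one. Qed.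
Lemma gquo_liftE n (x : A n) : gquo_lift n (gproj n x) = f n x.
Proof. exact: gquo_lift_funE. Qed.
End Lift.
End Ideal.

Section DGFacts.
Context (k : fieldType) (A : dgAlg k) (i j : int) (e : i + 1 = j).
Let L := diff_lin (dga_diff A) e.
Lemma dga_d0 : dga_d A e 0 = 0. Proof. exact: lin0 L. Qed.
Lemma dga_dD x y : dga_d A e (x + y) = dga_d A e x + dga_d A e y. Proof. exact: linD L _ _. Qed.
Lemma dga_dN x : dga_d A e (- x) = - dga_d A e x. Proof. exact: linN L _. Qed.
Lemma dga_dB x y : dga_d A e (x - y) = dga_d A e x - dga_d A e y. Proof. exact: linB L _ _. Qed.
Lemma dga_dZ c x : dga_d A e (c *: x) = c *: dga_d A e x. Proof. exact: linZ L _ _. Qed.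
End DGFacts.

Lemma deg_l (i j n m : int) : i + j = n -> n + 1 = m -> (i + 1) + j = m.
Proof. by move=> <- <-; rewrite addrAC. Qed.
Lemma deg_r (i j n m : int) : i + j = n -> n + 1 = m -> i + (j + 1) = m.
Proof. by move=> <- <-; rewrite addrA. Qed.

Lemma dga_d1 (k : fieldType) (A : dgAlg k) j (e : 0 + 1 = j) : dga_d A e (gone A) = 0.
Proof.
subst j; set e := erefl.
have := @dga_leibniz k A 0 0 0 1 1 1 erefl erefl erefl erefl erefl erefl (gone A) (gone A).
rewrite gmul1l gmul1l sgn0 scale1r gmul1r => /eqP.
by rewrite -{1}(addr0 (dga_d A _ _)) (inj_eq (addrI _)) eq_sym => /eqP.
Qed.

(* The quotient of a DG algebra by an ideal generated by S is DG as soon as d maps S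
   into the ideal. *)
Section DGQuo.
Context (k : fieldType) (A : dgAlg k).
Variable S : forall n, A n -> Prop.
Hypothesis dS : forall i j (e : i + 1 = j) (x : A i), S x -> ideal S (dga_d A e x).

Lemma ideal_d i j (e : i + 1 = j) (x : A i) : ideal S x -> ideal S (dga_d A e x).
Proof.
move=> H; elim: H j e => {i x}.
- by move=> i x Sx j e; apply: dS.
- by move=> i j e; rewrite dga_d0; apply: ideal0.
- by move=> i x y _ Hx _ Hy j e; rewrite dga_dD; apply: idealD.
- by move=> i c x _ Hx j e; rewrite dga_dZ; apply: idealZ.
- move=> i j n e x y Hy IH m em.
  rewrite (dga_leibniz e erefl erefl em (deg_l e em) (deg_r e em)).
  by apply/idealD/idealZ; apply: idealMl.
- move=> i j n e x y Hy IH m em.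
  rewrite (dga_leibniz e erefl erefl em (deg_l e em) (deg_r e em)).
  by apply/idealD/idealZ; apply: idealMr.
Qed.

Definition dgquo_d : gdiff (gquo S) := fun i j e x => gpi S (dga_d A e (grepr x)).
Lemma dgquo_dE i j (e : i + 1 = j) (x : A i) : dgquo_d e (gpi S x) = gpi S (dga_d A e x).
Proof. by apply/gpi_eq; rewrite -dga_dB; apply/ideal_d/grepr_pi. Qed.
Lemma dgquo_diff : is_diff dgquo_d.
Proof.
split.
  move=> i j e c; elim/gpi_ind => x; elim/gpi_ind => y.
  by rewrite -gpi_lin !dgquo_dE -gpi_lin dga_dD dga_dZ.
move=> i j n e e'; elim/gpi_ind => x; rewrite !dgquo_dE.
by rewrite (diff_sq (dga_diff A)).
Qed.
Lemma dgquo_leibniz : leibniz dgquo_d.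
Proof.
move=> i j n i' j' n' e ei ej en el er; elim/gpi_ind => x; elim/gpi_ind => y.
rewrite gpiM !dgquo_dE !gpiM (dga_leibniz e ei ej en el er).
by rewrite addrC gpi_lin addrC.
Qed.
Definition dgquo : dgAlg k := DGAlg dgquo_diff dgquo_leibniz.
End DGQuo.

(* The tensor algebra T(V), as the free unital associative graded algebra on V:
   formal expressions in homogeneous elements of V modulo the algebra laws and
   the linearity of V -> T(V).  See tlift_gen and tlift_uniq for its universal
   property. *)
Section TensorAlgebra.
Context (k : fieldType) (V : gspace k).

Inductive tterm : int -> Type :=
| TGen i (v : V i) : tterm i
| TOne : tterm 0
| TMul i j n (e : i + j = n) (s : tterm i) (t : tterm j) : tterm n
| TZero n : tterm n
| TAdd n (s t : tterm n) : tterm n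
| TOpp n (s : tterm n) : tterm n
| TScale n (c : k) (s : tterm n) : tterm n.

Inductive teq : forall n, tterm n -> tterm n -> Prop :=
| teq_refl n (s : tterm n) : teq s s
| teq_sym n (s t : tterm n) : teq s t -> teq t s
| teq_trans n (s t u : tterm n) : teq s t -> teq t u -> teq s u
| teq_cmul i j n (e : i + j = n) s s' t t' :
    teq s s' -> teq t t' -> teq (TMul e s t) (TMul e s' t')
| teq_cadd n (s s' t t' : tterm n) :
    teq s s' -> teq t t' -> teq (TAdd s t) (TAdd s' t')
| teq_copp n (s s' : tterm n) : teq s s' -> teq (TOpp s) (TOpp s')
| teq_cscale n c (s s' : tterm n) : teq s s' -> teq (TScale c s) (TScale c s')
| teq_addA n (s t u : tterm n) :
    teq (TAdd s (TAdd t u)) (TAdd (TAdd s t) u)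
| teq_addC n (s t : tterm n) : teq (TAdd s t) (TAdd t s)
| teq_add0 n (s : tterm n) : teq (TAdd (TZero n) s) s
| teq_addN n (s : tterm n) : teq (TAdd (TOpp s) s) (TZero n)
| teq_scaleA n a b (s : tterm n) : teq (TScale a (TScale b s)) (TScale (a * b) s)
| teq_scale1 n (s : tterm n) : teq (TScale 1 s) s
| teq_scaleDr n a (s t : tterm n) :
    teq (TScale a (TAdd s t)) (TAdd (TScale a s) (TScale a t))
| teq_scaleDl n a b (s : tterm n) :
    teq (TScale (a + b) s) (TAdd (TScale a s) (TScale b s))
| teq_mulDl i j n (e : i + j = n) c s s' t :
    teq (TMul e (TAdd (TScale c s) s') t)
        (TAdd (TScale c (TMul e s t)) (TMul e s' t))
| teq_mulDr i j n (e : i + j = n) c s t t' :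
    teq (TMul e s (TAdd (TScale c t) t'))
        (TAdd (TScale c (TMul e s t)) (TMul e s t'))
| teq_mulA i j l ij jl n (p : i + j = ij) (q : ij + l = n)
    (r : j + l = jl) (z : i + jl = n) s t u :
    teq (TMul q (TMul p s t) u) (TMul z s (TMul r t u))
| teq_mul1l n (e : 0 + n = n) s : teq (TMul e TOne s) s
| teq_mul1r n (e : n + 0 = n) s : teq (TMul e s TOne) s
| teq_gen i c (v w : V i) :
    teq (TGen (c *: v + w)) (TAdd (TScale c (TGen v)) (TGen w)).

Definition tpre n : preLmod k :=
  @PreLmod k (tterm n) (@teq n) (TZero n) (@TAdd n) (@TOpp n) (@TScale n)
    (@teq_refl n) (@teq_sym n) (@teq_trans n) (@teq_cadd n) (@teq_copp n)
    (@teq_cscale n) (@teq_addA n) (@teq_addC n) (@teq_add0 n) (@teq_addN n)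
    (@teq_scaleA n) (@teq_scale1 n) (@teq_scaleDr n) (@teq_scaleDl n).

Definition tens_alg_sp : gspace k := fun n => quo (tpre n).
Definition tpi n (s : tterm n) : tens_alg_sp n := @qpi k (tpre n) s.
Definition tmul i j n (e : i + j = n) (x : tens_alg_sp i) (y : tens_alg_sp j) :
  tens_alg_sp n := tpi (TMul e (qrepr x) (qrepr y)).

Lemma tpi_eq n (s t : tterm n) : tpi s = tpi t <-> teq s t.
Proof. exact: qpiP. Qed.
Lemma tpi_ind n (P : tens_alg_sp n -> Prop) : (forall s, P (tpi s)) -> forall x, P x.
Proof. exact: (@quo_ind k _ P). Qed.
Lemma tmulE i j n (e : i + j = n) s t : tmul e (tpi s) (tpi t) = tpi (TMul e s t).
Proof. by apply/tpi_eq/teq_cmul; apply: (@qreprP k (tpre _)). Qed.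
Lemma tpiD n (s t : tterm n) : tpi (TAdd s t) = tpi s + tpi t.
Proof. exact: (@qpiD k (tpre n)). Qed.
Lemma tpiZ n c (s : tterm n) : tpi (TScale c s) = c *: tpi s.
Proof. exact: (@qpiZ k (tpre n)). Qed.
Lemma tpiN n (s : tterm n) : tpi (TOpp s) = - tpi s.
Proof. exact: (@qpiN k (tpre n)). Qed.

Program Definition tens_alg : gAlg k :=
  @GAlg k tens_alg_sp tmul (tpi TOne) _ _ _ _ _.
Next Obligation.
elim/tpi_ind: y => y c; elim/tpi_ind => x; elim/tpi_ind => x'.
by rewrite -tpiZ -tpiD !tmulE -tpiZ -tpiD; apply/tpi_eq/teq_mulDl.
Qed.
Next Obligation.
elim/tpi_ind: x => x c; elim/tpi_ind => y; elim/tpi_ind => y'.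
by rewrite -tpiZ -tpiD !tmulE -tpiZ -tpiD; apply/tpi_eq/teq_mulDr.
Qed.
Next Obligation.
elim/tpi_ind: x => x; elim/tpi_ind: y => y; elim/tpi_ind: z => z.
by rewrite !tmulE; apply/tpi_eq/teq_mulA.
Qed.
Next Obligation. by elim/tpi_ind: x => x; rewrite tmulE; apply/tpi_eq/teq_mul1l. Qed.
Next Obligation. by elim/tpi_ind: x => x; rewrite tmulE; apply/tpi_eq/teq_mul1r. Qed.

Lemma tpiM i j n (e : i + j = n) s t :
  gmul tens_alg e (tpi s) (tpi t) = tpi (TMul e s t).
Proof. exact: tmulE. Qed.

Definition tgen i (v : V i) : tens_alg i := tpi (TGen v).
Lemma tgen_lin i : linear (@tgen i).
Proof. by move=> c v w; rewrite /tgen -tpiZ -tpiD; apply/tpi_eq/teq_gen. Qed.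

Lemma tens_alg_ind (P : forall n, tens_alg n -> Prop) :
  (forall i (v : V i), P i (tgen v)) -> P 0 (gone tens_alg) ->
  (forall i j n (e : i + j = n) x y, P i x -> P j y -> P n (gmul tens_alg e x y)) ->
  (forall n, P n 0) ->
  (forall n c x y, P n x -> P n y -> P n (c *: x + y)) ->
  forall n x, P n x.
Proof.
move=> Pg P1 PM P0 PL n; elim/tpi_ind.
elim=> {n} [i v||i j n e s Ps t Pt|n|n s Ps t Pt|n s Ps|n c s Ps].
- exact: Pg.
- exact: P1.
- by rewrite -tpiM; apply: PM.
- exact: P0.
- by rewrite tpiD -[tpi s]scale1r; apply: PL.
- by rewrite tpiN -scaleN1r -[X in P _ X]addr0; apply: PL.
- by rewrite tpiZ -[X in P _ X]addr0; apply: PL.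
Qed.

Section Lift.
Variables (B : gAlg k) (f : forall i, V i -> B i).
Hypothesis fL : forall i, linear (@f i).
Fixpoint teval n (s : tterm n) : B n :=
  match s with
  | TGen i v => f v
  | TOne => gone B
  | TMul i j n e s t => gmul B e (teval s) (teval t)
  | TZero n => 0
  | TAdd n s t => teval s + teval t
  | TOpp n s => - teval s
  | TScale n c s => c *: teval s
  end.
Lemma teval_eq n (s t : tterm n) : teq s t -> teval s = teval t.
Proof.
elim=> {n s t} //=.
- by move=> n s t u _ -> _ ->.
- by move=> i j n e s s' t t' _ -> _ ->.
- by move=> n s s' t t' _ -> _ ->.
- by move=> n s s' _ ->.
- by move=> n c s s' _ ->.
- by move=> n s t u; rewrite addrA.
- by move=> n s t; rewrite addrC.
- by move=> n s; rewrite add0r.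
- by move=> n s; rewrite addNr.
- by move=> n a b s; rewrite scalerA.
- by move=> n s; rewrite scale1r.
- by move=> n a s t; rewrite scalerDr.
- by move=> n a b s; rewrite scalerDl.
- by move=> i j n e c s s' t; rewrite gmulDl gmulZl.
- by move=> i j n e c s t t'; rewrite gmulDr gmulZr.
- by move=> i j l ij jl n p q r z s t u; rewrite (gmulA p q r z).
- by move=> n e s; rewrite gmul1l.
- by move=> n e s; rewrite gmul1r.
Qed.
Definition tlift_fun n (x : tens_alg n) : B n := teval (qrepr x).
Lemma tlift_funE n (s : tterm n) : tlift_fun (tpi s) = teval s.
Proof. by apply: teval_eq; apply: (@qreprP k (tpre n)). Qed.
Program Definition tlift : gHom tens_alg B := @GHom k tens_alg B tlift_fun _ _ _.
Next Obligation.
move=> c; elim/tpi_ind => x; elim/tpi_ind => y.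
by rewrite -tpiZ -tpiD !tlift_funE.
Qed.
Next Obligation.
elim/tpi_ind: x => x; elim/tpi_ind: y => y.
by rewrite tpiM !tlift_funE.
Qed.
Next Obligation. by rewrite tlift_funE. Qed.
Lemma tlift_gen i (v : V i) : tlift i (tgen v) = f v.
Proof. exact: tlift_funE. Qed.
Lemma tlift_uniq (g : gHom tens_alg B) :
  (forall i (v : V i), g i (tgen v) = f v) -> forall n x, g n x = tlift n x.
Proof.
move=> gf; apply: tens_alg_ind.
- by move=> i v; rewrite gf tlift_gen.
- by rewrite !gh_one.
- by move=> i j n e x y Hx Hy; rewrite !gh_mul Hx Hy.
- by move=> n; rewrite !gh0.
- by move=> n c x y Hx Hy; rewrite !ghD !ghZ Hx Hy.
Qed.
End Lift.

(* The extension of a differential of V to T(V) by the Leibniz rule. *)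
Section Diff.
Variables (d : gdiff V) (dP : is_diff d).
Fixpoint tdiff n (s : tterm n) : forall m, n + 1 = m -> tens_alg m :=
  match s in tterm n return forall m, n + 1 = m -> tens_alg m with
  | TGen i v => fun m e => tgen (d e v)
  | TOne => fun m e => 0
  | TMul i j n e s t => fun m em =>
      gmul tens_alg (deg_l e em) (tdiff s erefl) (tpi t)
      + sgn k i *: gmul tens_alg (deg_r e em) (tpi s) (tdiff t erefl)
  | TZero n => fun m e => 0
  | TAdd n s t => fun m e => tdiff s e + tdiff t e
  | TOpp n s => fun m e => - tdiff s e
  | TScale n c s => fun m e => c *: tdiff s e
  end.
Lemma tdiff_eq n (s t : tterm n) : teq s t -> forall m (e : n + 1 = m), tdiff s e = tdiff t e.
Proof.
elim=> {n s t} //=.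
- by move=> n s t u _ H _ H' m e; rewrite H H'.
- move=> i j n e s s' t t' E H E' H' m em.
  have -> : tpi s = tpi s' by apply/tpi_eq.
  have -> : tpi t = tpi t' by apply/tpi_eq.
  by rewrite H H'.
- by move=> n s s' t t' _ H _ H' m e; rewrite H H'.
- by move=> n s s' _ H m e; rewrite H.
- by move=> n c s s' _ H m e; rewrite H.
- by move=> n s t u m e; rewrite addrA.
- by move=> n s t m e; rewrite addrC.
- by move=> n s m e; rewrite add0r.
- by move=> n s m e; rewrite addNr.
- by move=> n a b s m e; rewrite scalerA.
- by move=> n s m e; rewrite scale1r.
- by move=> n a s t m e; rewrite scalerDr.
- by move=> n a b s m e; rewrite scalerDl.
- move=> i j n e c s s' t m em; rewrite tpiD tpiZ !gmulDl !gmulZl !scalerDr.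
  by rewrite !scalerA mulrC -!addrA; congr (_ + _); rewrite addrCA.
- move=> i j n e c s t t' m em; rewrite tpiD tpiZ !gmulDr !gmulZr !scalerDr.
  by rewrite !scalerA mulrC -!addrA; congr (_ + _); rewrite addrCA.
- move=> i j l ij jl n p q r z s t u m em.
  rewrite -!tpiM.
  rewrite !gmulDl !gmulDr !gmulZl !gmulZr !scalerDr scalerA -sgnD p -!addrA.
  have sjl : i + 1 + jl = m by rewrite -em -z addrAC.
  have iq : i + (j + 1 + l) = m by rewrite -em -z -r [j + 1 + l]addrAC !addrA.
  have iq' : i + (j + (l + 1)) = m by rewrite -em -z -r !addrA.
  congr (_ + (_ *: _ + _ *: _)).
  + exact: (@gmulA k tens_alg).
  + exact: (@gmulA k tens_alg).
  + exact: (@gmulA k tens_alg).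
- move=> n e s m em; rewrite gmul0l add0r scale1r.
  by apply/heqP; apply: (etrans (heq_mul1l _ _)); subst m; rewrite (eq_irrelevance (erefl _) _).
- move=> n e s m em; rewrite gmul0r scaler0 addr0.
  by apply/heqP; apply: (etrans (heq_mul1r _ _)); subst m.
- by move=> i c v w m e; rewrite (diff_lin dP) tgen_lin.
Qed.
Definition tens_alg_d : gdiff tens_alg := fun i j e x => tdiff (qrepr x) e.
Lemma tens_alg_dE i j (e : i + 1 = j) s : tens_alg_d e (tpi s) = tdiff s e.
Proof. by apply: tdiff_eq; apply: (@qreprP k (tpre _)). Qed.
Lemma tens_alg_d_lin i j (e : i + 1 = j) : linear (@tens_alg_d i j e).
Proof.
by move=> c; elim/tpi_ind => s; elim/tpi_ind => t; rewrite -tpiZ -tpiD !tens_alg_dE.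
Qed.
Lemma tens_alg_leibniz : leibniz tens_alg_d.
Proof.
move=> i j n i' j' n' e ei ej en el er; elim/tpi_ind => s; elim/tpi_ind => t.
subst i' j'; rewrite tpiM !tens_alg_dE /=.
by rewrite (eq_irrelevance (deg_l e en) el) (eq_irrelevance (deg_r e en) er).
Qed.
Lemma tens_alg_d_gen i j (e : i + 1 = j) (v : V i) : tens_alg_d e (tgen v) = tgen (d e v).
Proof. exact: tens_alg_dE. Qed.
Lemma tens_alg_d1 j (e : 0 + 1 = j) : tens_alg_d e (gone tens_alg) = 0.
Proof. exact: tens_alg_dE. Qed.
Lemma tens_alg_diff : is_diff tens_alg_d.
Proof.
split; first exact: tens_alg_d_lin.
move=> i j n e e' x; move: i x j n e e'; apply: tens_alg_ind.
- move=> i v j n e e'; rewrite !tens_alg_d_gen (diff_sq dP).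
  exact: lin0 (@tgen_lin n).
- by move=> j n e e'; rewrite tens_alg_d1 (lin0 (tens_alg_d_lin e')).
- move=> i j l e x y Hx Hy m n em en.
  rewrite (tens_alg_leibniz e erefl erefl em (deg_l e em) (deg_r e em)).
  rewrite (linD (tens_alg_d_lin en)) (linZ (tens_alg_d_lin en)).
  have e2 : i + 1 + (j + 1) = n by rewrite -en -em -e; ring.
  rewrite (tens_alg_leibniz _ erefl erefl en (deg_l (deg_l e em) en) e2).
  rewrite (tens_alg_leibniz _ erefl erefl en e2 (deg_r (deg_r e em) en)).
  rewrite Hx Hy gmul0l gmul0r add0r scaler0 addr0 -scalerDl sgnD sgn1.
  by rewrite mulrN1 addNr scale0r.
- by move=> i j n e e'; rewrite !(lin0 (tens_alg_d_lin _)).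
- move=> i c x y Hx Hy j n e e'; rewrite !tens_alg_d_lin.
  by rewrite Hx Hy scaler0 addr0.
Qed.
Definition tens_dgAlg : dgAlg k := DGAlg tens_alg_diff tens_alg_leibniz.
End Diff.
End TensorAlgebra.

(* (V (x) W)_n is generated by the pure tensors v (x) w with |v| + |w| = n, subject to
   bilinearity. *)
Section TensorProduct.
Context (k : fieldType) (V W : gspace k).
Section Deg.
Variable n : int.
Inductive pterm : Type :=
| PGen i j (e : i + j = n) (v : V i) (w : W j)
| PZero
| PAdd (s t : pterm)
| POpp (s : pterm)
| PScale (c : k) (s : pterm).

Inductive peq : pterm -> pterm -> Prop :=
| peq_refl s : peq s s
| peq_sym s t : peq s t -> peq t s
| peq_trans s t u : peq s t -> peq t u -> peq s u
| peq_cadd s s' t t' : peq s s' -> peq t t' -> peq (PAdd s t) (PAdd s' t')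
| peq_copp s s' : peq s s' -> peq (POpp s) (POpp s')
| peq_cscale c s s' : peq s s' -> peq (PScale c s) (PScale c s')
| peq_addA s t u : peq (PAdd s (PAdd t u)) (PAdd (PAdd s t) u)
| peq_addC s t : peq (PAdd s t) (PAdd t s)
| peq_add0 s : peq (PAdd PZero s) s
| peq_addN s : peq (PAdd (POpp s) s) PZero
| peq_scaleA a b s : peq (PScale a (PScale b s)) (PScale (a * b) s)
| peq_scale1 s : peq (PScale 1 s) s
| peq_scaleDr a s t : peq (PScale a (PAdd s t)) (PAdd (PScale a s) (PScale a t))
| peq_scaleDl a b s : peq (PScale (a + b) s) (PAdd (PScale a s) (PScale b s))
| peq_linl i j (e : i + j = n) c v v' w :
    peq (PGen e (c *: v + v') w) (PAdd (PScale c (PGen e v w)) (PGen e v' w))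
| peq_linr i j (e : i + j = n) c v w w' :
    peq (PGen e v (c *: w + w')) (PAdd (PScale c (PGen e v w)) (PGen e v w')).

Definition ppre : preLmod k :=
  PreLmod peq_refl peq_sym peq_trans peq_cadd peq_copp
    peq_cscale peq_addA peq_addC peq_add0 peq_addN
    peq_scaleA peq_scale1 peq_scaleDr peq_scaleDl.
End Deg.

Definition tens : gspace k := fun n => quo (ppre n).
Definition ppi n (s : pterm n) : tens n := @qpi k (ppre n) s.
Definition pure n i j (e : i + j = n) (v : V i) (w : W j) : tens n := ppi (PGen e v w).

Lemma ppi_eq n (s t : pterm n) : ppi s = ppi t <-> peq s t.
Proof. exact: qpiP. Qed.
Lemma ppi_ind n (P : tens n -> Prop) : (forall s, P (ppi s)) -> forall x, P x.
Proof. exact: (@quo_ind k _ P). Qed.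
Lemma ppiD n (s t : pterm n) : ppi (PAdd s t) = ppi s + ppi t.
Proof. exact: (@qpiD k (ppre n)). Qed.
Lemma ppiZ n c (s : pterm n) : ppi (PScale c s) = c *: ppi s.
Proof. exact: (@qpiZ k (ppre n)). Qed.
Lemma ppiN n (s : pterm n) : ppi (POpp s) = - ppi s.
Proof. exact: (@qpiN k (ppre n)). Qed.

Section Pure.
Variables (n i j : int) (e : i + j = n).
Lemma pure_linl w : linear ((pure e)^~ w).
Proof. by move=> c v v'; rewrite /pure -ppiZ -ppiD; apply/ppi_eq/peq_linl. Qed.
Lemma pure_linr v : linear (pure e v).
Proof. by move=> c w w'; rewrite /pure -ppiZ -ppiD; apply/ppi_eq/peq_linr. Qed.
Lemma pureDl v v' w : pure e (v + v') w = pure e v w + pure e v' w.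
Proof. exact: (linD (pure_linl w)). Qed.
Lemma pureDr v w w' : pure e v (w + w') = pure e v w + pure e v w'.
Proof. exact: (linD (pure_linr v)). Qed.
Lemma pureZl c v w : pure e (c *: v) w = c *: pure e v w.
Proof. exact: (linZ (pure_linl w)). Qed.
Lemma pureZr c v w : pure e v (c *: w) = c *: pure e v w.
Proof. exact: (linZ (pure_linr v)). Qed.
Lemma pureNl v w : pure e (- v) w = - pure e v w.
Proof. exact: (linN (pure_linl w)). Qed.
Lemma pureNr v w : pure e v (- w) = - pure e v w.
Proof. exact: (linN (pure_linr v)). Qed.
Lemma pure0l w : pure e 0 w = 0.
Proof. exact: (lin0 (pure_linl w)). Qed.
Lemma pure0r v : pure e v 0 = 0.
Proof. exact: (lin0 (pure_linr v)). Qed.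
End Pure.

Lemma pure_heq n i j i' j' (e : i + j = n) (e' : i' + j' = n)
    (v : V i) (v' : V i') (w : W j) (w' : W j') :
  heq v v' -> heq w w' -> pure e v w = pure e' v' w'.
Proof.
pose pure' (s : {i & V i}) (t : {j & W j}) (q : projT1 s + projT1 t = n) :=
  pure q (projT2 s) (projT2 t).
have pE s s' t t' : s = s' -> t = t' -> forall q q', pure' s t q = pure' s' t' q'.
  by move=> -> -> q q'; rewrite (eq_irrelevance q q').
by move=> hv hw; apply: (pE _ _ _ _ hv hw e e').
Qed.

Lemma tens_ind n (P : tens n -> Prop) :
  (forall i j (e : i + j = n) v w, P (pure e v w)) ->
  (forall c x y, P x -> P y -> P (c *: x + y)) -> forall x, P x.
Proof.
move=> Pp PL; have P0 : P 0.
  rewrite -(@pure0l n 0 n (add0r n) 0) -[pure _ _ _]addr0.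
  by rewrite -[0 in X in _ + X](addNr (pure (add0r n) 0 0)) addrC -addrA -scaleN1r;
     apply: (PL) => //; rewrite pure0l addr0 -(@pure0l n 0 n (add0r n) 0).
elim/ppi_ind; elim=> [i j e v w||s Ps t Pt|s Ps|c s Ps].
- exact: Pp.
- exact: P0.
- by rewrite ppiD -[ppi s]scale1r; apply: PL.
- by rewrite ppiN -scaleN1r -[X in P X]addr0; apply: PL.
- by rewrite ppiZ -[X in P X]addr0; apply: PL.
Qed.

Section Lift.
Variables (n : int) (Z : lmodType k).
Implicit Type f : forall i j : int, i + j = n -> V i -> W j -> Z.
Definition bilin f : Prop :=
  (forall i j e w, linear (fun v => f i j e v w)) /\
  (forall i j e v, linear (f i j e v)).
Fixpoint peval f (s : pterm n) : Z :=
  match s with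
  | PGen i j e v w => f i j e v w
  | PZero => 0
  | PAdd s t => peval f s + peval f t
  | POpp s => - peval f s
  | PScale c s => c *: peval f s
  end.
(* The linear map with pure e v w |-> f e v w; meaningful for bilinear f, see
   tens_lift_pure and tens_lift_lin. *)
Definition tens_lift f (x : tens n) : Z := peval f (qrepr x).

Section LiftBilin.
Variable f : forall i j : int, i + j = n -> V i -> W j -> Z.
Hypothesis fB : bilin f.
Lemma peval_eq (s t : pterm n) : peq s t -> peval f s = peval f t.
Proof.
case: fB => fl fr; elim=> {s t} //=.
- by move=> s t u _ -> _ ->.
- by move=> s s' t t' _ -> _ ->.
- by move=> s s' _ ->.
- by move=> c s s' _ ->.
- by move=> s t u; rewrite addrA.
- by move=> s t; rewrite addrC.
- by move=> s; rewrite add0r.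
- by move=> s; rewrite addNr.
- by move=> a b s; rewrite scalerA.
- by move=> s; rewrite scale1r.
- by move=> a s t; rewrite scalerDr.
- by move=> a b s; rewrite scalerDl.
- by move=> i j e c v v' w; apply: fl.
- by move=> i j e c v w w'; apply: fr.
Qed.
Lemma tens_liftE (s : pterm n) : tens_lift f (ppi s) = peval f s.
Proof. by apply: peval_eq; apply: (@qreprP k (ppre n)). Qed.
Lemma tens_lift_pure i j (e : i + j = n) v w : tens_lift f (pure e v w) = f e v w.
Proof. exact: tens_liftE. Qed.
Lemma tens_lift_lin : linear (tens_lift f).
Proof.
move=> c; elim/ppi_ind => s; elim/ppi_ind => t.
by rewrite -ppiZ -ppiD !tens_liftE.
Qed.
End LiftBilin.

Lemma tens_lift_comb f g h c x :
  (forall i j e v w, f i j e v w = c *: g i j e v w + h i j e v w) ->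
  tens_lift f x = c *: tens_lift g x + tens_lift h x.
Proof.
move=> E; rewrite /tens_lift; elim: (qrepr x) => [i j e v w||s Hs t Ht|s Hs|a s Hs] /=.
- exact: E.
- by rewrite scaler0 addr0.
- by rewrite Hs Ht scalerDr addrACA.
- by rewrite Hs opprD scalerN.
- by rewrite Hs scalerDr !scalerA mulrC.
Qed.
End Lift.
End TensorProduct.

Lemma deg22 (i1 i2 j1 j2 n1 n2 n : int) :
  n1 + n2 = n -> i1 + i2 = n1 -> j1 + j2 = n2 -> (i1 + j1) + (i2 + j2) = n.
Proof. by move=> <- <- <-; rewrite addrACA. Qed.

(* (b (x) c)(b' (x) c') = (-1)^{|c||b'|} bb' (x) cc', cf. tens_mul_pure. *)
Section TensorGAlg.
Context (k : fieldType) (B C : gAlg k).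
Definition tens_mul n1 n2 n (e : n1 + n2 = n) (x : tens B C n1) (y : tens B C n2) :
    tens B C n :=
  tens_lift (fun i1 i2 (e1 : i1 + i2 = n1) b c =>
    tens_lift (fun j1 j2 (e2 : j1 + j2 = n2) b' c' =>
      sgn k (i2 * j1) *: pure (deg22 e e1 e2) (gmul B erefl b b') (gmul C erefl c c'))
    y) x.

Lemma tens_mul_bilin2 n1 n2 n (e : n1 + n2 = n) i1 i2 (e1 : i1 + i2 = n1) (b : B i1) (c : C i2) :
  bilin (fun j1 j2 (e2 : j1 + j2 = n2) b' c' =>
      sgn k (i2 * j1) *: pure (deg22 e e1 e2) (gmul B erefl b b') (gmul C erefl c c')).
Proof.
split=> j1 j2 e2 u a v w.
  by rewrite gmulDr gmulZr pureDl pureZl scalerDr !scalerA mulrC.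
by rewrite gmulDr gmulZr pureDr pureZr scalerDr !scalerA mulrC.
Qed.
Lemma tens_mul_bilin1 n1 n2 n (e : n1 + n2 = n) (y : tens B C n2) :
  bilin (fun i1 i2 (e1 : i1 + i2 = n1) b c =>
    tens_lift (fun j1 j2 (e2 : j1 + j2 = n2) b' c' =>
      sgn k (i2 * j1) *: pure (deg22 e e1 e2) (gmul B erefl b b') (gmul C erefl c c'))
    y).
Proof.
split=> i1 i2 e1 u a v w; apply: tens_lift_comb => j1 j2 e2 b' c'.
  by rewrite gmulDl gmulZl pureDl pureZl scalerDr !scalerA mulrC.
by rewrite gmulDl gmulZl pureDr pureZr scalerDr !scalerA mulrC.
Qed.
Lemma tens_mul_pure n1 n2 n (e : n1 + n2 = n) i1 i2 (e1 : i1 + i2 = n1)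
    j1 j2 (e2 : j1 + j2 = n2) b c b' c' :
  tens_mul e (pure e1 b c) (pure e2 b' c') =
  sgn k (i2 * j1) *: pure (deg22 e e1 e2) (gmul B erefl b b') (gmul C erefl c c').
Proof.
rewrite /tens_mul tens_lift_pure; last exact: tens_mul_bilin1.
by rewrite tens_lift_pure //; apply: tens_mul_bilin2.
Qed.
Lemma tens_mul_linl n1 n2 n (e : n1 + n2 = n) (y : tens B C n2) : linear ((tens_mul e)^~ y).
Proof. exact: (tens_lift_lin (tens_mul_bilin1 e y)). Qed.
Lemma tens_mul_linr n1 n2 n (e : n1 + n2 = n) (x : tens B C n1) : linear (tens_mul e x).
Proof.
move=> c y y'; apply: tens_lift_comb => i1 i2 e1 u v.
by rewrite (tens_lift_lin (tens_mul_bilin2 e e1 u v)).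
Qed.

Program Definition tens_galg : gAlg k :=
  @GAlg k (tens B C) tens_mul (pure (addr0 0) (gone B) (gone C)) _ _ _ _ _.
Next Obligation. exact: tens_mul_linl. Qed.
Next Obligation. exact: tens_mul_linr. Qed.
Next Obligation.
elim/tens_ind: x => [i1 i2 e1 b c|a x x' Hx Hx']; last by rewrite !tens_mul_linl Hx Hx'.
elim/tens_ind: y => [j1 j2 e2 b' c'|a x x' Hx Hx']; last first.
  by rewrite tens_mul_linr !tens_mul_linl tens_mul_linr Hx Hx'.
elim/tens_ind: z => [l1 l2 e3 b'' c''|a x x' Hx Hx']; last first.
  by rewrite !tens_mul_linr Hx Hx'.
rewrite !tens_mul_pure (linZ (tens_mul_linl _ _)) (linZ (tens_mul_linr _ _)).
rewrite !tens_mul_pure !scalerA -!sgnD; congr (_ *: _).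
  by congr sgn; ring.
by apply: pure_heq; apply: heq_mulA.
Qed.
Next Obligation.
elim/tens_ind: x => [i1 i2 e1 b c|a x x' Hx Hx']; last by rewrite !tens_mul_linr Hx Hx'.
rewrite tens_mul_pure mul0r scale1r.
by apply: pure_heq; apply: heq_mul1l.
Qed.
Next Obligation.
elim/tens_ind: x => [i1 i2 e1 b c|a x x' Hx Hx']; last by rewrite !tens_mul_linl Hx Hx'.
rewrite tens_mul_pure mulr0 scale1r.
by apply: pure_heq; apply: heq_mul1r.
Qed.
End TensorGAlg.

(* Graded endomorphisms: an element of degree n maps V i to V (n + i). *)
Section GEnd.
Context (k : fieldType) (V : gspace k).
Record gend (n : int) := GEnd {
  ge_fun :> forall i j : int, n + i = j -> V i -> V j;
  ge_lin : forall i j (e : n + i = j), linear (@ge_fun i j e)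
}.
HB.instance Definition _ n := gen_eqMixin (gend n).
HB.instance Definition _ n := gen_choiceMixin (gend n).
Lemma gendP n (f g : gend n) : (forall i j (e : n + i = j) v, f i j e v = g i j e v) -> f = g.
Proof.
case: f g => [f fL] [g gL] /= E.
have fg : f = g.
  apply: functional_extensionality_dep => i; apply: functional_extensionality_dep => j.
  by apply: functional_extensionality_dep => e; apply/funext => v.
by subst g; congr GEnd; apply: Prop_irrelevance.
Qed.
Program Definition gend0 n : gend n := @GEnd n (fun i j e v => 0) _.
Next Obligation. by move=> c v w; rewrite scaler0 addr0. Qed.
Program Definition gendD n (f g : gend n) : gend n :=
  @GEnd n (fun i j e v => f i j e v + g i j e v) _.
Next Obligation. by move=> c v w; rewrite !ge_lin scalerDr addrACA. Qed.
Program Definition gendN n (f : gend n) : gend n := @GEnd n (fun i j e v => - f i j e v) _.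
Next Obligation. by move=> c v w; rewrite !ge_lin opprD scalerN. Qed.
Program Definition gendZ n (a : k) (f : gend n) : gend n :=
  @GEnd n (fun i j e v => a *: f i j e v) _.
Next Obligation. by move=> c v w; rewrite !ge_lin scalerDr !scalerA mulrC. Qed.
Lemma gend_addA n : associative (@gendD n).
Proof. by move=> f g h; apply: gendP => *; rewrite /= addrA. Qed.
Lemma gend_addC n : commutative (@gendD n).
Proof. by move=> f g; apply: gendP => *; rewrite /= addrC. Qed.
Lemma gend_add0 n : left_id (gend0 n) (@gendD n).
Proof. by move=> f; apply: gendP => *; rewrite /= add0r. Qed.
Lemma gend_addN n : left_inverse (gend0 n) (@gendN n) (@gendD n).
Proof. by move=> f; apply: gendP => *; rewrite /= addNr. Qed.
HB.instance Definition _ n := GRing.isZmodule.Build (gend n)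
  (@gend_addA n) (@gend_addC n) (@gend_add0 n) (@gend_addN n).
Lemma gend_scaleA n a b (f : gend n) : gendZ a (gendZ b f) = gendZ (a * b) f.
Proof. by apply: gendP => *; rewrite /= scalerA. Qed.
Lemma gend_scale1 n : left_id 1 (@gendZ n).
Proof. by move=> f; apply: gendP => *; rewrite /= scale1r. Qed.
Lemma gend_scaleDr n : right_distributive (@gendZ n) +%R.
Proof. by move=> a f g; apply: gendP => *; rewrite /= scalerDr. Qed.
Lemma gend_scaleDl n (f : gend n) : {morph (@gendZ n)^~ f : a b / a + b}.
Proof. by move=> a b; apply: gendP => *; rewrite /= scalerDl. Qed.
HB.instance Definition _ n := GRing.Zmodule_isLmodule.Build k (gend n)
  (@gend_scaleA n) (@gend_scale1 n) (@gend_scaleDr n) (@gend_scaleDl n).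

Lemma gendE n c (f g : gend n) i j (e : n + i = j) v :
  (c *: f + g) i j e v = c *: f i j e v + g i j e v.
Proof. by []. Qed.

Lemma deg_comp (n m l i j : int) : n + m = l -> l + i = j -> n + (m + i) = j.
Proof. by move=> <- <-; rewrite addrA. Qed.
Program Definition gend_mul n m l (e : n + m = l) (f : gend n) (g : gend m) : gend l :=
  @GEnd l (fun i j q v => f (m + i) j (deg_comp e q) (g i (m + i) erefl v)) _.
Next Obligation. by move=> c v w; rewrite !ge_lin. Qed.
Lemma deg_id (i j : int) : 0 + i = j -> i = j. Proof. by move<-; rewrite add0r. Qed.
Program Definition gend_one : gend 0 :=
  @GEnd 0 (fun i j q v => eq_rect i (fun n => V n) v j (deg_id q)) _.
Next Obligation.
by move=> c v w; move: (deg_id e) => {e} e; case: j / e => /=.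
Qed.
Lemma gend_fun_heq n (f : gend n) i i' j (e : n + i = j) (e' : n + i' = j) (v : V i) (v' : V i') :
  heq v v' -> f i j e v = f i' j e' v'.
Proof.
pose f' (s : {i & V i}) (q : n + projT1 s = j) := f _ _ q (projT2 s).
have pE s s' : s = s' -> forall q q', f' s q = f' s' q'.
  by move=> -> q q'; rewrite (eq_irrelevance q q').
by move=> h; apply: (pE _ _ h e e').
Qed.
Lemma heq_gend n (f : gend n) i i' j j' (e : n + i = j) (e' : n + i' = j') (v : V i) (v' : V i') :
  heq v v' -> heq (f i j e v) (f i' j' e' v').
Proof.
move=> h; have ii : i = i' by case: h.
have jj : j = j' by rewrite -e -e' ii.
by destruct jj; rewrite (gend_fun_heq _ _ e' h).
Qed.
Lemma gend_oneE i j (q : 0 + i = j) v : heq (gend_one i j q v) v.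
Proof. by rewrite /=; move: (deg_id q) => {q} E; case: j / E. Qed.

Program Definition gend_alg : gAlg k := @GAlg k gend gend_mul gend_one _ _ _ _ _.
Next Obligation. by move=> c f g; apply: gendP. Qed.
Next Obligation. by move=> c f g; apply: gendP => a b q v; rewrite /= ge_lin. Qed.
Next Obligation.
by apply: gendP => a b t v /=; apply: gend_fun_heq; apply: heq_gend.
Qed.
Next Obligation.
apply: gendP => a b t v; apply: heqP; rewrite [X in heq X]/=.
by apply: etrans (gend_oneE _ _) _; apply: heq_gend.
Qed.
Next Obligation.
by apply: gendP => a b t v /=; apply: gend_fun_heq; apply: gend_oneE.
Qed.
End GEnd.

Record is_dgLie (k : fieldType) (L : gspace k)
    (br : forall i j n : int, i + j = n -> L i -> L j -> L n) (d : gdiff L) : Prop :=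
  IsDGLie {
  br_linl : forall i j n (e : i + j = n) (y : L j), linear ((br i j n e)^~ y);
  br_linr : forall i j n (e : i + j = n) (x : L i), linear (br i j n e x);
  br_anti : forall i j n (e : i + j = n) (e' : j + i = n) (x : L i) (y : L j),
    br i j n e x y = - (sgn k (i * j) *: br j i n e' y x);
  br_jacobi : forall i j l ij jl il n (p : j + l = jl) (q : i + jl = n)
      (r : i + j = ij) (s : ij + l = n) (t : i + l = il) (u : j + il = n)
      (x : L i) (y : L j) (z : L l),
    br _ _ _ q x (br _ _ _ p y z) =
      br _ _ _ s (br _ _ _ r x y) z + sgn k (i * j) *: br _ _ _ u y (br _ _ _ t x z);
  br_diff : is_diff d;
  br_leibniz : forall i j n i' j' n' (e : i + j = n) (ei : i + 1 = i') (ej : j + 1 = j')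
      (en : n + 1 = n') (el : i' + j = n') (er : i + j' = n') (x : L i) (y : L j),
    d _ _ en (br _ _ _ e x y) =
      br _ _ _ el (d _ _ ei x) y + sgn k i *: br _ _ _ er x (d _ _ ej y)
}.

Record dgLie (k : fieldType) := DGLie {
  lie_sp :> int -> lmodType k;
  lie_br : forall i j n : int, i + j = n -> lie_sp i -> lie_sp j -> lie_sp n;
  lie_d : gdiff lie_sp;
  lieP : is_dgLie lie_br lie_d
}.
Arguments lie_br {k} L {i j n} e x y : rename, simpl never.
Arguments lie_d {k} L {i j} e x : rename, simpl never.

Record dgPoisson (k : fieldType) := DGPoisson {
  poi_alg :> dgAlg k;
  poi_comm : forall i j n (e : i + j = n) (e' : j + i = n) (x : poi_alg i) (y : poi_alg j),
    gmul poi_alg e x y = sgn k (i * j) *: gmul poi_alg e' y x;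
  poi_br : forall i j n : int, i + j = n -> poi_alg i -> poi_alg j -> poi_alg n;
  poi_lie : is_dgLie poi_br (@dga_d k poi_alg);
  poi_leibniz : forall i j l jl ij il n (p : j + l = jl) (q : i + jl = n)
      (r : i + j = ij) (s : ij + l = n) (t : i + l = il) (u : j + il = n)
      (x : poi_alg i) (y : poi_alg j) (z : poi_alg l),
    poi_br q x (gmul poi_alg p y z) =
      gmul poi_alg s (poi_br r x y) z + sgn k (i * j) *: gmul poi_alg u y (poi_br t x z)
}.
Arguments poi_br {k} A {i j n} e x y : rename, simpl never.

(* The underlying DG Lie algebra, with the same differential. *)
Definition poi_dgLie (k : fieldType) (A : dgPoisson k) : dgLie k := DGLie (poi_lie A).

(* env L = T(L) / (g (x) h - (-1)^{|g||h|} h (x) g - {g,h}); env_in g is the image of g : L i. *)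
Section Enveloping.
Context (k : fieldType) (L : dgLie k).
Local Notation T := (tens_dgAlg (br_diff (lieP L))).

Inductive env_rel : forall n, T n -> Prop :=
| EnvRel i j n (e : i + j = n) (e' : j + i = n) (g : L i) (h : L j) :
  env_rel (gmul T e (tgen g) (tgen h) - sgn k (i * j) *: gmul T e' (tgen h) (tgen g)
           - tgen (lie_br L e g h)).

Lemma tens_dga_d i j (e : i + 1 = j) (g : L i) : dga_d T e (tgen g) = tgen (lie_d L e g).
Proof. exact: (tens_alg_d_gen (br_diff (lieP L)) e g). Qed.

Lemma env_rel_d i j (e : i + 1 = j) (x : T i) : env_rel x -> ideal env_rel (dga_d T e x).
Proof.
move=> H; move: j e; case: i x / H => i j n e e' g h m em.
rewrite !dga_dB dga_dZ (dga_leibniz e erefl erefl em (deg_l e em) (deg_r e em)).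
rewrite (dga_leibniz e' erefl erefl em (deg_l e' em) (deg_r e' em)).
rewrite !tens_dga_d (br_leibniz (lieP L) e erefl erefl em (deg_l e em) (deg_r e em)).
pose X := EnvRel (deg_l e em) (deg_r e' em) (lie_d L erefl g) h.
pose Y := EnvRel (deg_r e em) (deg_l e' em) g (lie_d L erefl h).
apply: (ideal_eq (idealD (ideal_gen X) (idealZ (sgn k i) (ideal_gen Y)))).
rewrite (linD (@tgen_lin _ _ _)) (linZ (@tgen_lin _ _ _)).
rewrite sgnMDl1 sgnMDr1 !scalerBr !scalerDr !scalerA mulrCA sgn_sq mulr1 !opprD !addrA.
by rewrite [LHS](ACl (1*4*5*2*3*6)).
Qed.

Definition env : dgAlg k := dgquo env_rel_d.
Definition env_in i (g : L i) : env i := gpi (@env_rel) (tgen g).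

Lemma env_in_lin i : linear (@env_in i).
Proof. by move=> c x y; rewrite /env_in tgen_lin gpi_lin. Qed.
Lemma env_inD i x y : @env_in i (x + y) = env_in x + env_in y.
Proof. exact: (linD (@env_in_lin i)). Qed.
Lemma env_inZ i c x : @env_in i (c *: x) = c *: env_in x.
Proof. exact: (linZ (@env_in_lin i)). Qed.
Lemma env_in_br i j n (e : i + j = n) (e' : j + i = n) (g : L i) (h : L j) :
  env_in (lie_br L e g h) =
  gmul env e (env_in g) (env_in h) - sgn k (i * j) *: gmul env e' (env_in h) (env_in g).
Proof.
have /gpi_eq0 := ideal_gen (EnvRel e e' g h).
rewrite !(linB (@gpi_lin _ _ _ _)) (linZ (@gpi_lin _ _ _ _)) -!gpiM => /eqP.
by rewrite subr_eq0 => /eqP.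
Qed.
Lemma env_d_in i j (e : i + 1 = j) (g : L i) : dga_d env e (env_in g) = env_in (lie_d L e g).
Proof. exact: etrans (dgquo_dE env_rel_d e (tgen g)) (congr1 _ (tens_dga_d e g)). Qed.

Lemma env_ind (P : forall n, env n -> Prop) :
  P 0 (gone env) ->
  (forall i (g : L i), P i (env_in g)) ->
  (forall i j n (e : i + j = n) x y, P i x -> P j y -> P n (gmul env e x y)) ->
  (forall n, P n 0) ->
  (forall n c x y, P n x -> P n y -> P n (c *: x + y)) ->
  forall n x, P n x.
Proof.
move=> P1 Pg PM P0 PL n; elim/gpi_ind; move: n.
apply: tens_alg_ind => //.
- by move=> i j n e x y Hx Hy; rewrite -gpiM; apply: PM.
- by move=> n c x y Hx Hy; rewrite gpi_lin; apply: PL.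
Qed.

Section EnvLift.
Variables (B : gAlg k) (f : forall i, L i -> B i).
Hypothesis fL : forall i, linear (@f i).
Hypothesis fbr : forall i j n (e : i + j = n) (e' : j + i = n) (g : L i) (h : L j),
  f (lie_br L e g h) = gmul B e (f g) (f h) - sgn k (i * j) *: gmul B e' (f h) (f g).
Lemma env_lift_rel n (x : T n) : env_rel x -> tlift fL n x = 0.
Proof.
case=> {x n} i j n e e' g h; rewrite !ghB ghZ !gh_mul !tlift_gen.
by rewrite (fbr e e') subrr.
Qed.
Definition env_lift : gHom env B := gquo_lift env_lift_rel.
Lemma env_lift_in i (g : L i) : env_lift i (env_in g) = f g.
Proof. by rewrite /env_lift /env_in [LHS]gquo_liftE tlift_gen. Qed.
End EnvLift.

Local Notation UU := (tens_galg env env).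
(* h (x) 1 + 1 (x) h *)
Definition prim i (g : L i) : UU i :=
  pure (addr0 i) (env_in g) (gone env) + pure (add0r i) (gone env) (env_in g).
Lemma prim_lin i : linear (@prim i).
Proof.
by move=> c x y; rewrite /prim !env_in_lin pure_linl pure_linr scalerDr addrACA.
Qed.
Lemma uu_mul_pure n1 n2 n (e : n1 + n2 = n) i1 i2 (e1 : i1 + i2 = n1)
    j1 j2 (e2 : j1 + j2 = n2) b c b' c' :
  gmul UU e (pure e1 b c) (pure e2 b' c') =
  sgn k (i2 * j1) *: pure (deg22 e e1 e2) (gmul env erefl b b') (gmul env erefl c c').
Proof. exact: tens_mul_pure. Qed.
Lemma prim_br i j n (e : i + j = n) (e' : j + i = n) (g : L i) (h : L j) :
  prim (lie_br L e g h) = gmul UU e (prim g) (prim h) - sgn k (i * j) *: gmul UU e' (prim h) (prim g).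
Proof.
rewrite /prim !(env_in_br e e') !gmulDl !gmulDr !uu_mul_pure.
rewrite !(mul0r, mulr0, sgn0, scale1r).
have E1 a b c (q : a + b = c) (x : env a) (y : env b) (r : (a + b) + (0 + 0) = c) :
    pure r (gmul env erefl x y) (gmul env erefl (gone env) (gone env)) =
    pure (addr0 c) (gmul env q x y) (gone env).
  by apply: pure_heq; [apply: heq_mul|apply: heq_mul1l].
have E2 a b c (q : a + b = c) (x : env a) (y : env b) (r : (0 + 0) + (a + b) = c) :
    pure r (gmul env erefl (gone env) (gone env)) (gmul env erefl x y) =
    pure (add0r c) (gone env) (gmul env q x y).
  by apply: pure_heq; [apply: heq_mul1l|apply: heq_mul].
have E3 a b c (q : a + b = c) (x : env a) (y : env b) (r : (a + 0) + (0 + b) = c) :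
    pure r (gmul env erefl x (gone env)) (gmul env erefl (gone env) y) = pure q x y.
  by apply: pure_heq; [apply: heq_mul1r|apply: heq_mul1l].
have E4 a b c (q : b + a = c) (x : env a) (y : env b) (r : (0 + b) + (a + 0) = c) :
    pure r (gmul env erefl (gone env) y) (gmul env erefl x (gone env)) = pure q y x.
  by apply: pure_heq; [apply: heq_mul1l|apply: heq_mul1r].
rewrite !(E1 _ _ _ e) !(E1 _ _ _ e') !(E2 _ _ _ e) !(E2 _ _ _ e') !(E3 _ _ _ e) !(E3 _ _ _ e') !(E4 _ _ _ e) !(E4 _ _ _ e').
rewrite !(pureDl, pureDr, pureNl, pureNr, pureZl, pureZr) !scalerDr !scalerA.
rewrite [j * i]mulrC sgn_sq scale1r !opprD !addrA.
by rewrite [RHS](ACl (1*5*4*8*(2*7)*(3*6))) /= !subrr !addr0.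
Qed.

(* The comultiplication: the algebra map U -> U (x) U with h |-> h (x) 1 + 1 (x) h. *)
Definition env_comul : gHom env UU := env_lift prim_lin prim_br.
Lemma env_comul_in i (g : L i) : env_comul i (env_in g) = prim g.
Proof. exact: env_lift_in. Qed.
End Enveloping.

Lemma deg_smash (i1 i2 j1 j2 l1 l2 n1 n2 n : int) :
  n1 + n2 = n -> i1 + i2 = n1 -> j1 + j2 = n2 -> l1 + l2 = i2 ->
  (i1 + (l1 + j1)) + (l2 + j2) = n.
Proof. by move=> <- <- <- <-; ring. Qed.

Lemma deg_assoc (i n m j1 j2 : int) : i + n = m -> j1 + j2 = n -> (i + j1) + j2 = m.
Proof. by move=> <- <-; rewrite addrA. Qed.

Section Smash.
Context (k : fieldType) (A : dgPoisson k).
Local Notation L := (poi_dgLie A).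
Local Notation U := (env L).
Local Notation UU := (tens_galg U U).
Local Notation Delta := (env_comul L).
Local Notation iota h := (@env_in k L _ h).

Program Definition ad i (h : A i) : gend_alg A i :=
  @GEnd k A i (fun j n (e : i + j = n) (a : A j) => poi_br A e h a) _.
Next Obligation. exact: (br_linr (poi_lie A)). Qed.
Lemma ad_lin i : linear (@ad i).
Proof. by move=> c x y; apply: gendP => j n e a; apply: (br_linl (poi_lie A)). Qed.
Lemma ad_br i j n (e : i + j = n) (e' : j + i = n) (g : A i) (h : A j) :
  ad (poi_br A e g h) =
  gmul (gend_alg A) e (ad g) (ad h) - sgn k (i * j) *: gmul (gend_alg A) e' (ad h) (ad g).
Proof.
apply: gendP => l m em a.
rewrite -[RHS]/(poi_br A (deg_comp e em) g (poi_br A erefl h a)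
  - sgn k (i * j) *: poi_br A (deg_comp e' em) h (poi_br A erefl g a)).
rewrite (br_jacobi (poi_lie A) _ _ e em erefl (deg_comp e' em)).
by rewrite addrK.
Qed.

(* The left action of U(A) on A, determined by h . a = {h,a}: see act_in, act1, actM. *)
Definition env_act : gHom U (gend_alg A) := @env_lift _ L (gend_alg A) ad ad_lin ad_br.
Definition act i j n (e : i + j = n) (g : U i) (a : A j) : A n := env_act i g j n e a.

Lemma act1 j n (e : 0 + j = n) (a : A j) : heq (act e (gone U) a) a.
Proof. by rewrite /act gh_one; apply: gend_oneE. Qed.
Lemma act_in i j n (e : i + j = n) (h : A i) (a : A j) :
  act e (iota h) a = poi_br A e h a.
Proof. by rewrite /act [env_act i _]env_lift_in. Qed.
Lemma actM i j l m n (p : i + j = m) (q : m + l = n) (r : i + (j + l) = n) (g : U i) (h : U j) (a : A l) :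
  act q (gmul U p g h) a = act r g (act erefl h a).
Proof. by rewrite /act gh_mul (eq_irrelevance r (deg_comp p q)). Qed.
Lemma act_linl i j n (e : i + j = n) (a : A j) : linear (fun g : U i => act e g a).
Proof. by move=> c x y; rewrite /act gh_lin. Qed.
Lemma act_linr i j n (e : i + j = n) (g : U i) : linear (act e g).
Proof. exact: ge_lin. Qed.
Lemma heq_act i j j' n n' (e : i + j = n) (e' : i + j' = n') (g : U i) (a : A j) (a' : A j') :
  heq a a' -> heq (act e g a) (act e' g a').
Proof. exact: heq_gend. Qed.

(* (a # g)(b # h) = sum (-1)^{|g2||b|} a (g1 . b) # g2 h, where the innermost lift runs over
   Delta g = sum g1 (x) g2; cf. smash_mul_pure. *)
Definition smash_sp : gspace k := tens A U.

Definition smash_mul n1 n2 n (e : n1 + n2 = n) (x : smash_sp n1) (y : smash_sp n2) : smash_sp n :=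
  tens_lift (fun i1 i2 (e1 : i1 + i2 = n1) (a : A i1) (g : U i2) =>
    tens_lift (fun j1 j2 (e2 : j1 + j2 = n2) (b : A j1) (h : U j2) =>
      tens_lift (fun l1 l2 (e3 : l1 + l2 = i2) (g1 : U l1) (g2 : U l2) =>
        sgn k (l2 * j1) *:
          pure (deg_smash e e1 e2 e3)
            (gmul A erefl a (act erefl g1 b)) (gmul U erefl g2 h))
      (Delta i2 g)) y) x.

(* a . (b # h) = ab # h *)
Definition lmulX i n m (e : i + n = m) (a : A i) (x : smash_sp n) : smash_sp m :=
  tens_lift (fun j1 j2 (e1 : j1 + j2 = n) (b : A j1) (h : U j2) =>
     pure (deg_assoc e e1) (gmul A erefl a b) h) x.

Lemma lmulX_bilin i n m (e : i + n = m) (a : A i) :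
  bilin (fun j1 j2 (e1 : j1 + j2 = n) (b : A j1) (h : U j2) =>
     pure (deg_assoc e e1) (gmul A erefl a b) h).
Proof.
split=> j1 j2 e1 u c v w; first by rewrite gmul_linr pure_linl.
by rewrite pure_linr.
Qed.
Lemma lmulX_pure i n m (e : i + n = m) (a : A i) j1 j2 (e1 : j1 + j2 = n) (b : A j1) (h : U j2) :
  lmulX e a (pure e1 b h) = pure (deg_assoc e e1) (gmul A erefl a b) h.
Proof. by rewrite /lmulX tens_lift_pure //; apply: lmulX_bilin. Qed.
Lemma lmulX_linr i n m (e : i + n = m) (a : A i) : linear (lmulX e a).
Proof. exact: tens_lift_lin (lmulX_bilin e a). Qed.
Lemma lmulX_linl i n m (e : i + n = m) x : linear ((lmulX e)^~ x).
Proof.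
by move=> c a a'; apply: tens_lift_comb => j1 j2 e1 b h; rewrite gmul_linl pure_linl.
Qed.
Lemma lmulXA i j l n ij m (p : i + j = ij) (q : ij + n = m) (r : j + n = l) (s : i + l = m)
    (a : A i) (b : A j) (x : smash_sp n) :
  lmulX q (gmul A p a b) x = lmulX s a (lmulX r b x).
Proof.
elim/tens_ind: x => [j1 j2 e1 c h|c x y Hx Hy]; last by rewrite !lmulX_linr Hx Hy.
by rewrite !lmulX_pure; apply: pure_heq => //; apply: heq_mulA.
Qed.

(* For D = sum g1 (x) g2, the map b # h |-> sum (-1)^{|g2||b|} (g1 . b) # g2 h; thus
   (a # g) x = a . Lam (Delta g) x, see smash_mulE. *)
Definition Lam i n m (e : i + n = m) (D : UU i) (x : smash_sp n) : smash_sp m :=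
  tens_lift (fun j1 j2 (e2 : j1 + j2 = n) (b : A j1) (h : U j2) =>
    tens_lift (fun l1 l2 (e3 : l1 + l2 = i) (g1 : U l1) (g2 : U l2) =>
        sgn k (l2 * j1) *: pure (deg22 e e3 e2) (act erefl g1 b) (gmul U erefl g2 h))
      D) x.
Lemma Lam_bilinD i n m (e : i + n = m) j1 j2 (e2 : j1 + j2 = n) (b : A j1) (h : U j2) :
  bilin (fun l1 l2 (e3 : l1 + l2 = i) (g1 : U l1) (g2 : U l2) =>
    sgn k (l2 * j1) *: pure (deg22 e e3 e2) (act erefl g1 b) (gmul U erefl g2 h)).
Proof.
split=> l1 l2 e3 u c v w.
  by rewrite act_linl pure_linl scalerDr !scalerA mulrC.
by rewrite gmul_linl pure_linr scalerDr !scalerA mulrC.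
Qed.
Lemma Lam_bilinx i n m (e : i + n = m) (D : UU i) :
  bilin (fun j1 j2 (e2 : j1 + j2 = n) (b : A j1) (h : U j2) =>
    tens_lift (fun l1 l2 (e3 : l1 + l2 = i) (g1 : U l1) (g2 : U l2) =>
        sgn k (l2 * j1) *: pure (deg22 e e3 e2) (act erefl g1 b) (gmul U erefl g2 h))
      D).
Proof.
split=> l1 l2 e3 u c v w; apply: tens_lift_comb => j1 j2 e2 g1 g2.
  by rewrite act_linr pure_linl scalerDr !scalerA mulrC.
by rewrite gmul_linr pure_linr scalerDr !scalerA mulrC.
Qed.
Lemma Lam_pure i n m (e : i + n = m) l1 l2 (e3 : l1 + l2 = i) (g1 : U l1) (g2 : U l2)
  j1 j2 (e2 : j1 + j2 = n) (b : A j1) (h : U j2) :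
  Lam e (pure e3 g1 g2 : UU i) (pure e2 b h) =
  sgn k (l2 * j1) *: pure (deg22 e e3 e2) (act erefl g1 b) (gmul U erefl g2 h).
Proof.
rewrite /Lam tens_lift_pure; last exact: Lam_bilinx.
by rewrite tens_lift_pure //; apply: Lam_bilinD.
Qed.
Lemma Lam_linx i n m (e : i + n = m) (D : UU i) : linear (Lam e D).
Proof. exact: tens_lift_lin (Lam_bilinx e D). Qed.
Lemma Lam_linD i n m (e : i + n = m) (x : smash_sp n) : linear (fun D : UU i => Lam e D x).
Proof.
move=> c D D'; apply: tens_lift_comb => j1 j2 e2 b h.
exact: tens_lift_lin (Lam_bilinD e e2 b h) c D D'.
Qed.
Lemma LamM i j n ij jn m (p : i + j = ij) (q : ij + n = m) (r : j + n = jn) (s : i + jn = m)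
    (D : UU i) (D' : UU j) (x : smash_sp n) :
  Lam q (gmul UU p D D') x = Lam s D (Lam r D' x).
Proof.
elim/tens_ind: D => [i1 i2 e1 g1 g2|c D1 D2 H1 H2]; last first.
  by rewrite gmul_linl !Lam_linD H1 H2.
elim/tens_ind: D' => [j1 j2 e2 h1 h2|c D1 D2 H1 H2]; last first.
  by rewrite gmul_linr !Lam_linD Lam_linx H1 H2.
elim/tens_ind: x => [l1 l2 e3 b h|c x y Hx Hy]; last first.
  by rewrite !Lam_linx Hx Hy.
rewrite [gmul UU _ _ _]uu_mul_pure (linZ (Lam_linD q _)) !Lam_pure (linZ (Lam_linx s _)) Lam_pure.
rewrite !scalerA -!sgnD; congr (_ *: _).
  by congr sgn; ring.
apply: pure_heq; last exact: heq_mulA.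
have E : i1 + (j1 + l1) = i1 + j1 + l1 by rewrite addrA.
by rewrite (actM _ _ E); apply: heq_act.
Qed.
Lemma Lam1 n (e : 0 + n = n) (x : smash_sp n) : Lam e (gone UU) x = x.
Proof.
elim/tens_ind: x => [i1 i2 e1 b h|c x y Hx Hy]; last by rewrite Lam_linx Hx Hy.
rewrite [Lam _ _ _]Lam_pure mul0r scale1r.
by apply: pure_heq; [apply: act1|apply: heq_mul1l].
Qed.

Lemma smash_bilin3 n1 n2 n (e : n1 + n2 = n) i1 i2 (e1 : i1 + i2 = n1) (a : A i1)
    j1 j2 (e2 : j1 + j2 = n2) (b : A j1) (h : U j2) :
  bilin (fun l1 l2 (e3 : l1 + l2 = i2) (g1 : U l1) (g2 : U l2) =>
        sgn k (l2 * j1) *: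
          pure (deg_smash e e1 e2 e3)
            (gmul A erefl a (act erefl g1 b)) (gmul U erefl g2 h)).
Proof.
split=> l1 l2 e3 u c v w.
  by rewrite act_linl gmul_linr pure_linl scalerDr !scalerA mulrC.
by rewrite gmul_linl pure_linr scalerDr !scalerA mulrC.
Qed.
Lemma smash_bilin2 n1 n2 n (e : n1 + n2 = n) i1 i2 (e1 : i1 + i2 = n1) (a : A i1) (g : U i2) :
  bilin (fun j1 j2 (e2 : j1 + j2 = n2) (b : A j1) (h : U j2) =>
      tens_lift (fun l1 l2 (e3 : l1 + l2 = i2) (g1 : U l1) (g2 : U l2) =>
        sgn k (l2 * j1) *:
          pure (deg_smash e e1 e2 e3)
            (gmul A erefl a (act erefl g1 b)) (gmul U erefl g2 h))
      (Delta i2 g)).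
Proof.
split=> j1 j2 e2 u c v w; apply: tens_lift_comb => l1 l2 e3 g1 g2.
  by rewrite act_linr gmul_linr pure_linl scalerDr !scalerA mulrC.
by rewrite gmul_linr pure_linr scalerDr !scalerA mulrC.
Qed.
Lemma smash_bilin1 n1 n2 n (e : n1 + n2 = n) (y : smash_sp n2) :
  bilin (fun i1 i2 (e1 : i1 + i2 = n1) (a : A i1) (g : U i2) =>
    tens_lift (fun j1 j2 (e2 : j1 + j2 = n2) (b : A j1) (h : U j2) =>
      tens_lift (fun l1 l2 (e3 : l1 + l2 = i2) (g1 : U l1) (g2 : U l2) =>
        sgn k (l2 * j1) *:
          pure (deg_smash e e1 e2 e3)
            (gmul A erefl a (act erefl g1 b)) (gmul U erefl g2 h))
      (Delta i2 g)) y).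
Proof.
split=> i1 i2 e1 u c v w; apply: tens_lift_comb => j1 j2 e2 b h.
  apply: tens_lift_comb => l1 l2 e3 g1 g2.
  by rewrite gmul_linl pure_linl scalerDr !scalerA mulrC.
by rewrite gh_lin (tens_lift_lin (smash_bilin3 e e1 u e2 b h)).
Qed.

Lemma smash_mul_linl n1 n2 n (e : n1 + n2 = n) y : linear (fun x : smash_sp n1 => smash_mul e x y).
Proof. exact: tens_lift_lin (smash_bilin1 e y). Qed.
Lemma smash_mul_linr n1 n2 n (e : n1 + n2 = n) x : linear (@smash_mul n1 n2 n e x).
Proof.
move=> c y y'; apply: tens_lift_comb => i1 i2 e1 a g.
by rewrite (tens_lift_lin (smash_bilin2 e e1 a g)).
Qed.

Lemma smash_mul_pure n1 n2 n (e : n1 + n2 = n) i1 i2 (e1 : i1 + i2 = n1) (a : A i1) (g : U i2)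
    j1 j2 (e2 : j1 + j2 = n2) (b : A j1) (h : U j2) :
  smash_mul e (pure e1 a g) (pure e2 b h) =
  tens_lift (fun l1 l2 (e3 : l1 + l2 = i2) (g1 : U l1) (g2 : U l2) =>
        sgn k (l2 * j1) *:
          pure (deg_smash e e1 e2 e3)
            (gmul A erefl a (act erefl g1 b)) (gmul U erefl g2 h)) (Delta i2 g).
Proof.
rewrite /smash_mul tens_lift_pure; last exact: smash_bilin1.
by rewrite tens_lift_pure //; apply: smash_bilin2.
Qed.

Lemma smash_mulE n1 n2 n m (e : n1 + n2 = n) i1 i2 (e1 : i1 + i2 = n1) (a : A i1) (g : U i2)
    (q : i2 + n2 = m) (r : i1 + m = n) (y : smash_sp n2) :
  smash_mul e (pure e1 a g) y = lmulX r a (Lam q (Delta i2 g) y).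
Proof.
elim/tens_ind: y => [j1 j2 e2 b h|c x y Hx Hy]; last first.
  by rewrite smash_mul_linr Lam_linx lmulX_linr Hx Hy.
rewrite smash_mul_pure; elim/tens_ind: (Delta i2 g) => [l1 l2 e3 g1 g2|c x y Hx Hy]; last first.
  by rewrite (tens_lift_lin (smash_bilin3 e e1 a e2 b h)) Lam_linD lmulX_linr Hx Hy.
rewrite tens_lift_pure; last exact: smash_bilin3.
rewrite Lam_pure (linZ (lmulX_linr _ _)) lmulX_pure; congr (_ *: _).
by apply: pure_heq.
Qed.

Lemma smash_lmul i n1 n2 n l m (p : i + n1 = l) (q : l + n2 = n) (r : n1 + n2 = m) (s : i + m = n)
    (a : A i) (x : smash_sp n1) (y : smash_sp n2) :
  smash_mul q (lmulX p a x) y = lmulX s a (smash_mul r x y).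
Proof.
elim/tens_ind: x => [j1 j2 e2 b h|c x x' Hx Hx']; last first.
  by rewrite lmulX_linr !smash_mul_linl lmulX_linr Hx Hx'.
have Em : j1 + (j2 + n2) = m by rewrite -r -e2 addrA.
have En : i + j1 + (j2 + n2) = n by rewrite -s -Em !addrA.
by rewrite lmulX_pure (smash_mulE q _ _ _ erefl En) (smash_mulE r _ _ _ erefl Em) (lmulXA _ _ Em s).
Qed.

Lemma deg_Kap (l1 l2 i j n m p : int) :
  j + n = p -> i + p = m -> l1 + l2 = i -> (l1 + j) + (l2 + n) = m.
Proof. by move=> <- <- <-; rewrite addrACA. Qed.
(* For D = sum g1 (x) g2, the sum of (-1)^{|g2||b|} (g1 . b) . Lam (Delta g2) x. *)
Definition Kap i j n p m (f : j + n = p) (e : i + p = m) (D : UU i) (b : A j) (x : smash_sp n) : smash_sp m :=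
  tens_lift (fun l1 l2 (e3 : l1 + l2 = i) (g1 : U l1) (g2 : U l2) =>
    sgn k (l2 * j) *: lmulX (deg_Kap f e e3) (act erefl g1 b) (Lam erefl (Delta l2 g2) x)) D.
Lemma Kap_bilin i j n p m (f : j + n = p) (e : i + p = m) (b : A j) (x : smash_sp n) :
  bilin (fun l1 l2 (e3 : l1 + l2 = i) (g1 : U l1) (g2 : U l2) =>
    sgn k (l2 * j) *: lmulX (deg_Kap f e e3) (act erefl g1 b) (Lam erefl (Delta l2 g2) x)).
Proof.
split=> l1 l2 e3 u c v w.
  by rewrite act_linl lmulX_linl scalerDr !scalerA mulrC.
by rewrite gh_lin Lam_linD lmulX_linr scalerDr !scalerA mulrC.
Qed.
Lemma Kap_pure i j n p m (f : j + n = p) (e : i + p = m) (b : A j) (x : smash_sp n)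
  l1 l2 (e3 : l1 + l2 = i) (g1 : U l1) (g2 : U l2) :
  Kap f e (pure e3 g1 g2 : UU i) b x =
    sgn k (l2 * j) *: lmulX (deg_Kap f e e3) (act erefl g1 b) (Lam erefl (Delta l2 g2) x).
Proof. by rewrite /Kap tens_lift_pure //; apply: Kap_bilin. Qed.
Lemma Kap_linD i j n p m (f : j + n = p) (e : i + p = m) (b : A j) (x : smash_sp n) :
  linear (fun D : UU i => Kap f e D b x).
Proof. exact: tens_lift_lin (Kap_bilin f e b x). Qed.

Lemma lmulX_heq i i' n n' m (e : i + n = m) (e' : i' + n' = m) (a : A i) (a' : A i')
    (x : smash_sp n) (x' : smash_sp n') :
  heq a a' -> heq x x' -> lmulX e a x = lmulX e' a' x'.
Proof.
pose l' (s : {i & A i}) (t : {j & smash_sp j}) (q : projT1 s + projT1 t = m) :=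
  lmulX q (projT2 s) (projT2 t).
have pE s s' t t' : s = s' -> t = t' -> forall q q', l' s t q = l' s' t' q'.
  by move=> -> -> q q'; rewrite (eq_irrelevance q q').
by move=> ha hx; apply: (pE _ _ _ _ ha hx e e').
Qed.
Lemma heq_Lam i n m m' (e : i + n = m) (e' : i + n = m') (D : UU i) (x : smash_sp n) :
  heq (Lam e D x) (Lam e' D x).
Proof. by destruct e; destruct e'. Qed.

Lemma Kap_pureE i j n p m (f : j + n = p) (e : i + p = m) (b : A j) (x : smash_sp n)
  l1 l2 (e3 : l1 + l2 = i) (g1 : U l1) (g2 : U l2) u v
  (p1 : l1 + j = u) (p2 : l2 + n = v) (q : u + v = m) :
  Kap f e (pure e3 g1 g2 : UU i) b x =
    sgn k (l2 * j) *: lmulX q (act p1 g1 b) (Lam p2 (Delta l2 g2) x).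
Proof. by rewrite Kap_pure; destruct p1, p2; rewrite (eq_irrelevance q (deg_Kap f e e3)). Qed.
Lemma Kap_linx i j n p m (f : j + n = p) (e : i + p = m) (D : UU i) (b : A j) :
  linear (Kap f e D b).
Proof.
move=> c x y; apply: tens_lift_comb => l1 l2 e3 g1 g2.
by rewrite Lam_linx lmulX_linr scalerDr !scalerA mulrC.
Qed.

Lemma Lam_in i n m (e : i + n = m) (h : A i) j1 j2 (e2 : j1 + j2 = n) (b : A j1) (w : U j2)
  u v (p : i + j1 = u) (q : u + j2 = m) (r : i + j2 = v) (s : j1 + v = m) :
  Lam e (Delta i (iota h)) (pure e2 b w) =
  pure q (poi_br A p h b) w + sgn k (i * j1) *: pure s b (gmul U r (iota h) w).
Proof.
rewrite env_comul_in (linD (Lam_linD _ _)) !Lam_pure mul0r scale1r.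
congr (_ + _ *: _); apply: pure_heq.
- by destruct p; rewrite act_in.
- exact: heq_mul1l.
- exact: act1.
- exact: heq_mul.
Qed.

Lemma Lam_Kap i (g : U i) :
  (forall j n p m (f : j + n = p) (e : i + p = m) (b : A j) (x : smash_sp n),
    Lam e (Delta i g) (lmulX f b x) = Kap f e (Delta i g) b x) ->
  forall i' ii j n p m m' (f : j + n = p) (e : i' + p = m) (e' : i + m = m')
    (r : i + i' = ii) (t : ii + p = m') (D : UU i') (b : A j) (x : smash_sp n),
  Lam e' (Delta i g) (Kap f e D b x) = Kap f t (gmul UU r (Delta i g) D) b x.
Proof.
move=> IH i' ii j n p m m' f e e' r t D b x.
elim/tens_ind: D => [l1 l2 e3 g1 g2|c D D' H H']; last first.
  by rewrite Kap_linD Lam_linx gmul_linr Kap_linD H H'.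
rewrite Kap_pure (linZ (Lam_linx _ _)) IH.
elim/tens_ind: (Delta i g) => [u1 u2 e4 h1 h2|c D D' H H']; last first.
  by rewrite Kap_linD gmul_linl Kap_linD -H -H' scalerDr !scalerA mulrC.
rewrite uu_mul_pure (linZ (Kap_linD _ _ _ _)) !Kap_pure !scalerA -!sgnD gh_mul.
have E : u2 + (l2 + n) = u2 + l2 + n by rewrite addrA.
rewrite (LamM _ _ erefl E); congr (_ *: _); first by congr sgn; ring.
have E1 : u1 + (l1 + j) = u1 + l1 + j by rewrite addrA.
rewrite (actM _ _ E1); apply: lmulX_heq; last exact: heq_Lam.
exact: heq_act.
Qed.

Lemma Lam_lmul i (g : U i) : forall j n p m (f : j + n = p) (e : i + p = m) (b : A j) (x : smash_sp n),
  Lam e (Delta i g) (lmulX f b x) = Kap f e (Delta i g) b x.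
Proof.
move: i g; apply: env_ind.
- move=> j n p m f e b x.
  have pm : p = m by rewrite -e add0r.
  destruct pm; rewrite gh_one Lam1 [RHS](Kap_pureE f e _ _ _ _ _ (add0r j) (add0r n) f).
  rewrite mul0r scale1r gh_one Lam1.
  by apply: esym; apply: lmulX_heq => //; apply: act1.
- move=> i h j n p m f e b x.
  elim/tens_ind: x => [j1 j2 e2 c w|c x y Hx Hy]; last first.
    by rewrite lmulX_linr Lam_linx Kap_linx Hx Hy.
  have Em : i + (j + j1) + j2 = m by rewrite -e -f -e2; ring.
  have Ejm : j + j1 + (i + j2) = m by rewrite -e -f -e2; ring.
  have Eh : i + j + n = m by rewrite -e -f addrA.
  have Eb : j + (i + n) = m by rewrite -e -f; ring.
  have Ec : i + j1 + j2 = i + n by rewrite -e2 addrA.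
  have Ed : j1 + (i + j2) = i + n by rewrite -e2; ring.
  have Es : i + j + j1 = i + (j + j1) by rewrite addrA.
  have Eu : j + (i + j1) = i + (j + j1) by ring.
  rewrite lmulX_pure (Lam_in e h _ _ _ erefl Em erefl Ejm).
  rewrite [in RHS]env_comul_in (linD (Kap_linD _ _ _ _)).
  rewrite (Kap_pureE f e b (pure e2 c w) (addr0 i) _ _ erefl (add0r n) Eh).
  rewrite (Kap_pureE f e b (pure e2 c w) (add0r i) _ _ (add0r j) erefl Eb).
  rewrite mul0r scale1r gh_one Lam1 act_in lmulX_pure (heqP (act1 (add0r j) b)).
  rewrite (Lam_in erefl h e2 c w erefl Ec erefl Ed).
  rewrite (linD (lmulX_linr _ _)) (linZ (lmulX_linr _ _)) !lmulX_pure.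
  rewrite (poi_leibniz erefl erefl erefl Es erefl Eu) pureDl pureZl scalerDr scalerA -addrA.
  rewrite [i * (j + j1)]mulrDr sgnD.
  congr (_ + (_ *: _ + _ *: _)); apply: pure_heq => //; exact: heq_mul.
- move=> i i' ii r g g' IH IH' j n p m f e b x.
  have E : i + (i' + p) = m by rewrite -e -r addrA.
  by rewrite gh_mul (LamM _ _ erefl E) IH' (Lam_Kap IH _ _ _ r e).
- by move=> n j n0 p m f e b x; rewrite gh0 (lin0 (Lam_linD _ _)) (lin0 (Kap_linD _ _ _ _)).
- move=> n c g g' H H' j n0 p m f e b x.
  by rewrite gh_lin Lam_linD Kap_linD H H'.
Qed.

Lemma smash_Lam i n1 n2 n l m (p : i + n1 = l) (q : l + n2 = n) (r : n1 + n2 = m) (s : i + m = n)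
    (g : U i) (x : smash_sp n1) (y : smash_sp n2) :
  smash_mul q (Lam p (Delta i g) x) y = Lam s (Delta i g) (smash_mul r x y).
Proof.
elim/tens_ind: x => [j1 j2 e2 b h|c x x' Hx Hx']; last first.
  by rewrite Lam_linx !smash_mul_linl Lam_linx Hx Hx'.
have Em : j1 + (j2 + n2) = m by rewrite -r -e2 addrA.
rewrite (smash_mulE r _ _ _ erefl Em) Lam_lmul.
elim/tens_ind: (Delta i g) => [l1 l2 e3 g1 g2|c D D' H H']; last first.
  by rewrite Lam_linD smash_mul_linl Kap_linD H H'.
rewrite Lam_pure Kap_pure (linZ (smash_mul_linl _ _)); congr (_ *: _).
have E1 : l2 + j2 + n2 = l2 + (j2 + n2) by rewrite addrA.
have E2 : l1 + j1 + (l2 + (j2 + n2)) = n by rewrite -s -Em -e3; ring.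
rewrite (smash_mulE q _ _ _ E1 E2) gh_mul (LamM _ _ erefl erefl).
exact: lmulX_heq.
Qed.

Lemma poi_br1 i n (e : i + 0 = n) (h : A i) : poi_br A e h (gone A) = 0.
Proof.
have ni : i = n by rewrite -e addr0.
destruct ni; have e0 : 0 + i = i by rewrite add0r.
have := poi_leibniz (addr0 0) e e e e e0 h (gone A) (gone A).
rewrite gmul1l gmul1r gmul1l mulr0 scale1r => /eqP.
by rewrite -[X in X == _]addr0 (inj_eq (addrI _)) eq_sym => /eqP.
Qed.

Lemma Lam_one i (g : U i) : forall j n m (e : i + n = m) (p : 0 + j = n) (q : 0 + m = m)
    (r : i + j = m) (w : U j),
  Lam e (Delta i g) (pure p (gone A) w) = pure q (gone A) (gmul U r g w).
Proof.
move: i g; apply: env_ind.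
- move=> j n m e p q r w.
  have jm : j = m by rewrite -r add0r.
  have jn : j = n by rewrite -p add0r.
  destruct jn; destruct jm; rewrite gh_one Lam1.
  by apply: pure_heq => //; rewrite gmul1l.
- move=> i h j n m e p q r w.
  have E : i + 0 + j = m by rewrite addr0.
  by rewrite (Lam_in e h p (gone A) w erefl E r q) poi_br1 pure0l add0r mulr0 scale1r.
- move=> i i' ii f g g' IH IH' j n m e p q r w.
  have E1 : i + (i' + n) = m by rewrite -e -f addrA.
  have E2 : 0 + (i' + j) = i' + n by rewrite -p add0r add0r.
  have E3 : i + (i' + j) = m by rewrite -r -f addrA.
  have E4 : 0 + (i' + n) = i' + n by rewrite add0r.
  have E5 : i' + j = i' + n by rewrite -p add0r.
  rewrite gh_mul (LamM _ _ erefl E1) (IH' _ _ _ erefl p E4 E5).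
  have E6 : i + (i' + n) = m by [].
  by rewrite (IH _ _ _ E1 E4 q E6); apply: pure_heq => //; rewrite (gmulA f r E5 E6).
- by move=> i j n m e p q r w; rewrite gh0 (lin0 (Lam_linD _ _)) gmul0l pure0r.
- move=> i c g g' H H' j n m e p q r w.
  by rewrite gh_lin Lam_linD (H _ _ _ e p q r) (H' _ _ _ e p q r) gmul_linl pure_linr.
Qed.

Definition smash_one : smash_sp 0 := pure (addr0 0) (gone A) (gone U).

Program Definition smash_alg : gAlg k := @GAlg k smash_sp smash_mul smash_one _ _ _ _ _.
Next Obligation. exact: smash_mul_linl. Qed.
Next Obligation. exact: smash_mul_linr. Qed.
Next Obligation.
elim/tens_ind: x => [i1 i2 e1 a g|c x x' Hx Hx']; last by rewrite !smash_mul_linl Hx Hx'.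
have E1 : i1 + (i2 + j) = ij by rewrite -p -e1 addrA.
have E2 : i1 + (i2 + jl) = n by rewrite -s -e1 addrA.
have E3 : i2 + j + l = i2 + jl by rewrite -r addrA.
have E4 : i1 + (i2 + jl) = n by rewrite -s -e1 addrA.
rewrite (smash_mulE p _ _ _ erefl E1) (smash_mulE s _ _ _ erefl E4).
by rewrite (smash_lmul _ _ E3 E4) (smash_Lam _ _ r erefl).
Qed.
Next Obligation.
have E : 0 + i = i by rewrite add0r.
rewrite /smash_one (smash_mulE e _ _ _ E E) gh_one Lam1.
elim/tens_ind: x => [i1 i2 e1 a g|c x x' Hx Hx']; last by rewrite !lmulX_linr Hx Hx'.
by rewrite lmulX_pure; apply: pure_heq => //; apply: heq_mul1l.
Qed.
Next Obligation.
elim/tens_ind: x => [i1 i2 e1 a g|c x x' Hx Hx']; last by rewrite !smash_mul_linl Hx Hx'.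
have E1 : i1 + i2 = i by [].
have E0 : i2 + 0 = i2 by rewrite addr0.
rewrite (smash_mulE e _ _ _ E0 E1).
rewrite /smash_one (Lam_one _ _ _ (add0r i2) E0) gmul1r.
by rewrite lmulX_pure; apply: pure_heq => //; exact: heq_mul1r.
Qed.

(* d(a # h) = d(a) # h + (-1)^{|a|} a # d(h) *)
Definition smash_d : gdiff smash_alg := fun n m e x =>
  tens_lift (fun i j (p : i + j = n) (a : A i) (h : U j) =>
    pure (deg_l p e) (dga_d A erefl a) h
    + sgn k i *: pure (deg_r p e) a (dga_d U erefl h)) x.
Lemma smash_d_bilin n m (e : n + 1 = m) :
  bilin (fun i j (p : i + j = n) (a : A i) (h : U j) =>
    pure (deg_l p e) (dga_d A erefl a) h
    + sgn k i *: pure (deg_r p e) a (dga_d U erefl h)).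
Proof.
split=> i j p u c v w.
  rewrite (diff_lin (dga_diff A)) !pure_linl !scalerDr !scalerA [_ * c]mulrC.
  by rewrite addrACA.
rewrite (diff_lin (dga_diff U)) !pure_linr !scalerDr !scalerA [_ * c]mulrC.
by rewrite addrACA.
Qed.
Lemma smash_d_lin n m (e : n + 1 = m) : linear (@smash_d n m e).
Proof. exact: tens_lift_lin (smash_d_bilin e). Qed.
Lemma smash_d_pure n m (e : n + 1 = m) i j (p : i + j = n) (a : A i) (h : U j)
  i' j' (q : i + 1 = i') (r : j + 1 = j') (s : i' + j = m) (t : i + j' = m) :
  smash_d e (pure p a h) = pure s (dga_d A q a) h + sgn k i *: pure t a (dga_d U r h).
Proof.
rewrite /smash_d tens_lift_pure; last exact: smash_d_bilin.
destruct q; destruct r.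
by rewrite (eq_irrelevance s (deg_l p e)) (eq_irrelevance t (deg_r p e)).
Qed.
Lemma smash_diff : is_diff smash_d.
Proof.
split; first exact: smash_d_lin.
move=> i j n e e'; elim/tens_ind=> [i1 i2 p a h|c x y Hx Hy]; last first.
  by rewrite !smash_d_lin Hx Hy scaler0 addr0.
rewrite (smash_d_pure e p a h erefl erefl (deg_l p e) (deg_r p e)).
rewrite (linD (smash_d_lin e')) (linZ (smash_d_lin e')).
have E : i1 + 1 + (i2 + 1) = n by rewrite -e' -e -p; ring.
rewrite (smash_d_pure e' _ _ h erefl erefl (deg_l (deg_l p e) e') E).
rewrite (smash_d_pure e' _ _ _ erefl erefl E (deg_r (deg_r p e) e')).
rewrite !(diff_sq (dga_diff _)) pure0l pure0r add0r scaler0 addr0 -scalerDl sgnD sgn1.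
by rewrite mulrN1 addNr scale0r.
Qed.
Lemma smash_d_lmul i n m i' n' m' (p : i + n = m) (ei : i + 1 = i') (en : n + 1 = n')
    (em : m + 1 = m') (q : i' + n = m') (r : i + n' = m') (a : A i) (x : smash_sp n) :
  smash_d em (lmulX p a x) =
  lmulX q (dga_d A ei a) x + sgn k i *: lmulX r a (smash_d en x).
Proof.
elim/tens_ind: x => [j1 j2 e b h|c x y Hx Hy]; last first.
  rewrite lmulX_linr !smash_d_lin !lmulX_linr Hx Hy !scalerDr.
  by rewrite !scalerA mulrC addrACA.
subst i' n' m'.
rewrite !lmulX_pure (smash_d_pure erefl e b h erefl erefl (deg_l e erefl) (deg_r e erefl)).
have E1 : i + j1 + 1 + j2 = m + 1 by rewrite -p -e; ring.
have E2 : i + j1 + (j2 + 1) = m + 1 by rewrite -p -e; ring.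
rewrite (smash_d_pure _ _ _ _ erefl erefl E1 E2).
have E3 : i + 1 + j1 = i + j1 + 1 by ring.
have E4 : i + (j1 + 1) = i + j1 + 1 by ring.
rewrite (dga_leibniz erefl erefl erefl erefl E3 E4) pureDl pureZl.
rewrite (linD (lmulX_linr _ _)) (linZ (lmulX_linr _ _)) !lmulX_pure.
rewrite scalerDr scalerA -sgnD addrA; congr (_ + _ *: _ + _ *: _); apply: pure_heq => //; exact: heq_mul.
Qed.

Lemma smash_d_Lam i (g : U i) : forall n m i' n' m' (p : i + n = m) (ei : i + 1 = i')
    (en : n + 1 = n') (em : m + 1 = m') (q : i' + n = m') (r : i + n' = m') (x : smash_sp n),
  smash_d em (Lam p (Delta i g) x) =
  Lam q (Delta i' (dga_d U ei g)) x + sgn k i *: Lam r (Delta i g) (smash_d en x).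
Proof.
move: i g; apply: env_ind.
- move=> n m i' n' m' p ei en em q r x.
  have nm : n = m by rewrite -p add0r.
  have nm' : n' = m' by rewrite -r add0r.
  destruct nm; destruct nm'; rewrite dga_d1 gh0 (lin0 (Lam_linD _ _)) gh_one !Lam1 add0r scale1r.
  by rewrite (eq_irrelevance em en).
- move=> i h n m i' n' m' p ei en em q r x.
  elim/tens_ind: x => [j1 j2 e b w|c x y Hx Hy]; last first.
    rewrite Lam_linx !smash_d_lin !Lam_linx Hx Hy !scalerDr.
    by rewrite !scalerA mulrC addrACA.
  subst i' n' m'.
  have F1 : i + j1 + j2 = m by rewrite -p -e addrA.
  have F2 : j1 + (i + j2) = m by rewrite -p -e addrCA.
  have G1 : i + j1 + 1 + j2 = m + 1 by rewrite -F1; ring.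
  have G2 : i + j1 + (j2 + 1) = m + 1 by rewrite -F1; ring.
  have G3 : j1 + 1 + (i + j2) = m + 1 by rewrite -F2; ring.
  have G4 : j1 + (i + j2 + 1) = m + 1 by rewrite -F2; ring.
  have K1 : i + 1 + j1 = i + j1 + 1 by ring.
  have K2 : i + (j1 + 1) = i + j1 + 1 by ring.
  have K3 : i + 1 + j2 = i + j2 + 1 by ring.
  have K4 : i + (j2 + 1) = i + j2 + 1 by ring.
  rewrite env_d_in (Lam_in p h e b w erefl F1 erefl F2).
  rewrite (Lam_in q _ e b w K1 G1 K3 G4).
  rewrite (linD (smash_d_lin _)) (linZ (smash_d_lin _)).
  rewrite (smash_d_pure _ _ _ _ erefl erefl G1 G2) (smash_d_pure _ _ _ _ erefl erefl G3 G4).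
  rewrite (smash_d_pure _ _ _ _ erefl erefl (deg_l e erefl) (deg_r e erefl)).
  rewrite (linD (Lam_linx _ _)) (linZ (Lam_linx _ _)).
  rewrite (Lam_in r h _ _ _ K2 G1 erefl G3) (Lam_in r h _ _ _ erefl G2 K4 G4).
  rewrite (br_leibniz (poi_lie A) erefl erefl erefl erefl K1 K2).
  rewrite (dga_leibniz erefl erefl erefl erefl K3 K4) env_d_in.
  rewrite pureDl pureDr pureZl pureZr !scalerDr !scalerA sgnMDl1 sgnMDr1 sgnD !addrA.
  rewrite [RHS](ACl (1*3*5*4*2*6)) /=.
  congr (_ + _ + _ + _ *: _ + _ + _ *: _); first by rewrite mulrCA sgn_sq mulr1.
  ring.
- move=> i j ij f g g' IH IH' n m i' n' m' p ei en em q r x.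
  have E1 : i + (j + n) = m by rewrite -p -f addrA.
  have E2 : i + 1 + (j + n) = m' by rewrite -em -E1; ring.
  have E3 : i + (j + n + 1) = m' by rewrite -em -E1; ring.
  have E4 : j + 1 + n = j + n + 1 by ring.
  have E5 : j + n' = j + n + 1 by rewrite -en; ring.
  have E6 : i + 1 + j = i' by rewrite -ei -f; ring.
  have E7 : i + (j + 1) = i' by rewrite -ei -f; ring.
  rewrite !gh_mul (LamM _ _ erefl E1) (IH _ _ _ _ _ E1 erefl erefl em E2 E3).
  rewrite (IH' _ _ _ _ _ erefl erefl en erefl E4 E5).
  rewrite (dga_leibniz f erefl erefl ei E6 E7) ghD ghZ !gh_mul.
  rewrite (linD (Lam_linD _ _)) (linZ (Lam_linD _ _)).
  rewrite (LamM _ _ erefl E2) (LamM _ _ E4 E3) (LamM _ _ E5 E3).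
  rewrite (linD (Lam_linx _ _)) (linZ (Lam_linx _ _)) scalerDr scalerA -sgnD f.
  by rewrite addrA.
- move=> i n m i' n' m' p ei en em q r x.
  by rewrite dga_d0 !gh0 !(lin0 (Lam_linD _ _)) (lin0 (smash_d_lin _)) scaler0 addr0.
- move=> i c g g' H H' n m i' n' m' p ei en em q r x.
  rewrite !gh_lin dga_dD dga_dZ !gh_lin !Lam_linD smash_d_lin.
  rewrite (H _ _ _ _ _ _ ei en _ q r) (H' _ _ _ _ _ _ ei en _ q r) !scalerDr !scalerA [c * _]mulrC.
  by rewrite addrACA.
Qed.

Lemma smash_gmulE n1 n2 n m (e : n1 + n2 = n) i1 i2 (e1 : i1 + i2 = n1) (a : A i1) (g : U i2)
    (q : i2 + n2 = m) (r : i1 + m = n) (y : smash_alg n2) :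
  gmul smash_alg e (pure e1 a g : smash_alg n1) y = lmulX r a (Lam q (Delta i2 g) y).
Proof. exact: smash_mulE. Qed.

Lemma smash_leibniz : leibniz smash_d.
Proof.
move=> i j n i' j' n' e ei ej en el er x y.
elim/tens_ind: x => [i1 i2 p a g|c x x' Hx Hx']; last first.
  rewrite gmul_linl !smash_d_lin !gmul_linl Hx Hx' !scalerDr !scalerA mulrC.
  by rewrite addrACA.
have E1 : i1 + (i2 + j) = n by rewrite -e -p addrA.
have E2 : i1 + 1 + (i2 + j) = n' by rewrite -en -E1; ring.
have E3 : i1 + (i2 + j + 1) = n' by rewrite -en -E1; ring.
have E4 : i2 + 1 + j = i2 + j + 1 by ring.
have E5 : i2 + j' = i2 + j + 1 by rewrite -ej; ring.
have E6 : i1 + 1 + i2 = i' by rewrite -ei -p; ring.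
have E7 : i1 + (i2 + 1) = i' by rewrite -ei -p; ring.
rewrite (smash_gmulE e _ _ _ erefl E1).
rewrite (smash_d_lmul E1 erefl erefl en E2 E3) (smash_d_Lam _ _ erefl ej _ E4 E5).
rewrite (smash_d_pure ei p a g erefl erefl E6 E7) gmulDl gmulZl.
rewrite (smash_gmulE el _ _ _ erefl E2) (smash_gmulE el _ _ _ E4 E3).
rewrite (smash_gmulE er _ _ _ E5 E3).
rewrite (linD (lmulX_linr _ _)) (linZ (lmulX_linr _ _)) scalerDr scalerA -sgnD p.
by rewrite addrA.
Qed.
Definition smash_dgAlg : dgAlg k := DGAlg smash_diff smash_leibniz.
End Smash.



Section AE.
Context (k : fieldType) (A : dgPoisson k).
Local Notation AU := (smash_dgAlg A).
Local Notation iota h := (@env_in k (poi_dgLie A) _ h).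

(* 1 # ab - a # b - (-1)^{|a||b|} b # a, the right-hand factors being images in U(A) *)
Inductive AE_rel : forall n, AU n -> Prop :=
| AERel i j n (z : 0 + n = n) (e : i + j = n) (e' : j + i = n) (a : A i) (b : A j) :
  AE_rel (pure z (gone A) (iota (gmul A e a b)) - pure e a (iota b)
          - sgn k (i * j) *: pure e' b (iota a) : AU n).

Lemma smash_dgE n m (e : n + 1 = m) i j (p : i + j = n) (a : A i) (h : env (poi_dgLie A) j)
  i' j' (q : i + 1 = i') (r : j + 1 = j') (s : i' + j = m) (t : i + j' = m) :
  dga_d AU e (pure p a h) = pure s (dga_d A q a) h + sgn k i *: pure t a (dga_d _ r h).
Proof. exact: smash_d_pure. Qed.

Lemma AE_rel_d i j (e : i + 1 = j) (x : AU i) : AE_rel x -> ideal AE_rel (dga_d AU e x).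
Proof.
move=> H; move: j e; case: i x / H => i j n z e e' a b m em.
have zm : 0 + m = m by rewrite add0r.
have z1 : 0 + 1 + n = m by rewrite add0r addrC.
rewrite !dga_dB dga_dZ (smash_dgE em z _ _ erefl em z1 zm).
rewrite (smash_dgE em e _ _ erefl erefl (deg_l e em) (deg_r e em)).
rewrite (smash_dgE em e' _ _ erefl erefl (deg_l e' em) (deg_r e' em)).
rewrite dga_d1 pure0l add0r sgn0 scale1r !env_d_in.
rewrite [lie_d _ em _](dga_leibniz e erefl erefl em (deg_l e em) (deg_r e em)).
pose X := AERel zm (deg_l e em) (deg_r e' em) (dga_d A erefl a) b.
pose Y := AERel zm (deg_r e em) (deg_l e' em) a (dga_d A erefl b).
apply: (ideal_eq (idealD (ideal_gen X) (idealZ (sgn k i) (ideal_gen Y)))).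
rewrite env_inD env_inZ pureDr pureZr.
rewrite sgnMDl1 sgnMDr1 !scalerBr !scalerDr !scalerA mulrCA sgn_sq mulr1 !opprD !addrA.
by rewrite [LHS](ACl (1*3*6*2*4*5)).
Qed.

Definition AE : dgAlg k := dgquo AE_rel_d.
End AE.

Section Ae.
Context (k : fieldType) (A : dgPoisson k).

(* The graded space m_A (+) h_A, with m_a = (a, 0) and h_a = (0, a).  Its differential
   is given by m_a |-> m_{d a} and h_a |-> h_{d a}. *)
Definition mh_sp : gspace k := fun i => (A i * A i)%type.
Definition mh_d : gdiff mh_sp := fun i j e x => (dga_d A e x.1, dga_d A e x.2).
Lemma mh_diff : is_diff mh_d.
Proof.
split.
  by move=> i j e c x y; rewrite /mh_d /= !(diff_lin (dga_diff A)).
by move=> i j n e e' x; rewrite /mh_d /= !(diff_sq (dga_diff A)).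
Qed.
Local Notation T := (tens_dgAlg mh_diff).

Definition mgen i (a : A i) : T i := @tgen k mh_sp i (a, 0).
Definition hgen i (a : A i) : T i := @tgen k mh_sp i (0, a).

(* Differences of the two sides of the defining relations. *)
Inductive Ae_rel : forall n, T n -> Prop :=
| Ae_mM i j n (e : i + j = n) (a : A i) (b : A j) :
    Ae_rel (mgen (gmul A e a b) - gmul T e (mgen a) (mgen b))
| Ae_hM i j n (e : i + j = n) (e' : j + i = n) (a : A i) (b : A j) :
    Ae_rel (hgen (gmul A e a b) - (gmul T e (mgen a) (hgen b)
              + sgn k (i * j) *: gmul T e' (mgen b) (hgen a)))
| Ae_mB i j n (e : i + j = n) (e' : j + i = n) (a : A i) (b : A j) :
    Ae_rel (mgen (poi_br A e a b) - (gmul T e (hgen a) (mgen b)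
              - sgn k (i * j) *: gmul T e' (mgen b) (hgen a)))
| Ae_hB i j n (e : i + j = n) (e' : j + i = n) (a : A i) (b : A j) :
    Ae_rel (hgen (poi_br A e a b) - (gmul T e (hgen a) (hgen b)
              - sgn k (i * j) *: gmul T e' (hgen b) (hgen a)))
| Ae_m1 : Ae_rel (mgen (gone A) - gone T).

Lemma mgen_lin i : linear (@mgen i).
Proof.
move=> c x y; rewrite /mgen -tgen_lin; congr tgen.
by congr pair; rewrite /= scaler0 addr0.
Qed.
Lemma hgen_lin i : linear (@hgen i).
Proof.
move=> c x y; rewrite /hgen -tgen_lin; congr tgen.
by congr pair; rewrite /= scaler0 addr0.
Qed.
Lemma mgen_d i j (e : i + 1 = j) (a : A i) : dga_d T e (mgen a) = mgen (dga_d A e a).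
Proof. by rewrite /mgen [LHS](tens_alg_d_gen mh_diff e) /mh_d /= dga_d0. Qed.
Lemma hgen_d i j (e : i + 1 = j) (a : A i) : dga_d T e (hgen a) = hgen (dga_d A e a).
Proof. by rewrite /hgen [LHS](tens_alg_d_gen mh_diff e) /mh_d /= dga_d0. Qed.

Lemma Ae_rel_d i j (e : i + 1 = j) (x : T i) : Ae_rel x -> ideal Ae_rel (dga_d T e x).
Proof.
move=> H; move: j e; case: i x / H => [i j n e a b|i j n e e' a b|i j n e e' a b|i j n e e' a b|] m em.
- pose X := Ae_mM (deg_l e em) (dga_d A erefl a) b.
  pose Y := Ae_mM (deg_r e em) a (dga_d A erefl b).
  apply: (ideal_eq (idealD (ideal_gen X) (idealZ (sgn k i) (ideal_gen Y)))).
  rewrite !dga_dB mgen_d !(dga_leibniz e erefl erefl em (deg_l e em) (deg_r e em)) !mgen_d.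
  rewrite (linD (@mgen_lin _)) (linZ (@mgen_lin _)) scalerBr opprD !addrA.
  by rewrite [LHS](ACl (1*3*2*4)).
- pose X := Ae_hM (deg_l e em) (deg_r e' em) (dga_d A erefl a) b.
  pose Y := Ae_hM (deg_r e em) (deg_l e' em) a (dga_d A erefl b).
  apply: (ideal_eq (idealD (ideal_gen X) (idealZ (sgn k i) (ideal_gen Y)))).
  rewrite !dga_dB dga_dD dga_dZ hgen_d.
  rewrite !(dga_leibniz e erefl erefl em (deg_l e em) (deg_r e em)).
  rewrite !(dga_leibniz e' erefl erefl em (deg_l e' em) (deg_r e' em)) !(mgen_d, hgen_d).
  rewrite (linD (@hgen_lin _)) (linZ (@hgen_lin _)) sgnMDl1 sgnMDr1.
  rewrite !scalerBr !scalerDr !scalerA mulrCA sgn_sq mulr1 !opprD !addrA.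
  by rewrite [LHS](ACl (1*3*6*2*4*5)).
- pose X := Ae_mB (deg_l e em) (deg_r e' em) (dga_d A erefl a) b.
  pose Y := Ae_mB (deg_r e em) (deg_l e' em) a (dga_d A erefl b).
  apply: (ideal_eq (idealD (ideal_gen X) (idealZ (sgn k i) (ideal_gen Y)))).
  rewrite !dga_dB dga_dZ mgen_d (br_leibniz (poi_lie A) e erefl erefl em (deg_l e em) (deg_r e em)).
  rewrite !(dga_leibniz e erefl erefl em (deg_l e em) (deg_r e em)).
  rewrite !(dga_leibniz e' erefl erefl em (deg_l e' em) (deg_r e' em)) !(mgen_d, hgen_d).
  rewrite (linD (@mgen_lin _)) (linZ (@mgen_lin _)) sgnMDl1 sgnMDr1.
  rewrite !scalerBr !scalerDr !scalerA mulrCA sgn_sq mulr1 !opprB !opprD !addrA.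
  by rewrite [LHS](ACl (1*4*5*2*3*6)).
- pose X := Ae_hB (deg_l e em) (deg_r e' em) (dga_d A erefl a) b.
  pose Y := Ae_hB (deg_r e em) (deg_l e' em) a (dga_d A erefl b).
  apply: (ideal_eq (idealD (ideal_gen X) (idealZ (sgn k i) (ideal_gen Y)))).
  rewrite !dga_dB dga_dZ hgen_d (br_leibniz (poi_lie A) e erefl erefl em (deg_l e em) (deg_r e em)).
  rewrite !(dga_leibniz e erefl erefl em (deg_l e em) (deg_r e em)).
  rewrite !(dga_leibniz e' erefl erefl em (deg_l e' em) (deg_r e' em)) !(mgen_d, hgen_d).
  rewrite (linD (@hgen_lin _)) (linZ (@hgen_lin _)) sgnMDl1 sgnMDr1.
  rewrite !scalerBr !scalerDr !scalerA mulrCA sgn_sq mulr1 !opprB !opprD !addrA.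
  by rewrite [LHS](ACl (1*4*5*2*3*6)).
- rewrite dga_dB mgen_d !dga_d1 (lin0 (@mgen_lin _)) subrr; exact: ideal0.
Qed.

Definition Ae : dgAlg k := dgquo Ae_rel_d.
End Ae.

(* Main.v *)
Require Import Defs.
From mathcomp Require Import all_boot all_algebra.

(** A map out of A # U(A) is a pair consisting of an algebra map on A and a Lie
    map on A satisfying the commutation relation of [1 # h] with [b # 1].
    Taking a |-> m_a and a |-> h_a gives A # U(A) -> A^e, and the relation for
    h_{ab} says that this kills I.  In the other direction m_a |-> a # 1 and
    h_a |-> 1 # a.  Since A # U(A) is generated by the elements a # 1 and
    1 # h, the two maps are seen to be inverse to each other on generators. *)

Set Implicit Arguments.
Unset Strict Implicit.
Unset Printing Implicit Defensive.

Import GRing.Theory.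
Local Open Scope ring_scope.

(** * Induced maps and differentials *)

Section LiftDifferential.
Context (k : fieldType).

(** Both sides obey the same Leibniz rule over the lifted algebra map, so agreement on generators
    propagates to all of T(V). The target degree is quantified after [x] to keep it free in the
    induction. *)
Lemma tlift_d (V : gspace k) (d : gdiff V) (dP : is_diff d) (B : dgAlg k)
    (f : forall i, V i -> B i) (fL : forall i, linear (f i)) :
  (forall i j (e : i + 1 = j) (v : V i), f j (d i j e v) = dga_d B e (f i v)) ->
  forall i (x : tens_dgAlg dP i) j (e : i + 1 = j),
  tlift fL j (dga_d (tens_dgAlg dP) e x) = dga_d B e (tlift fL i x).
Proof.
move=> fd; apply: tens_alg_ind.
- by move=> i v j e; rewrite [dga_d (tens_dgAlg dP) _ _](tens_alg_d_gen dP) !tlift_gen.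
- by move=> j e; rewrite (@dga_d1 _ (tens_dgAlg dP)) gh0 gh_one dga_d1.
- move=> i j n e x y Hx Hy m em.
  rewrite (@dga_leibniz _ (tens_dgAlg dP) _ _ _ _ _ _ e erefl erefl em
    (deg_l e em) (deg_r e em)).
  rewrite gh_mul (dga_leibniz e erefl erefl em (deg_l e em) (deg_r e em)).
  by rewrite ghD ghZ !gh_mul Hx Hy.
- by move=> i j e; rewrite dga_d0 !gh0 dga_d0.
- by move=> n c x y Hx Hy j e; rewrite dga_dD dga_dZ !ghD !ghZ dga_dD dga_dZ Hx Hy.
Qed.

Lemma gquo_lift_d (A B : dgAlg k) (S : forall n, A n -> Prop)
    (dS : forall i j (e : i + 1 = j) (x : A i), S i x -> ideal S (dga_d A e x))
    (f : gHom A B) (fS : forall n (x : A n), S n x -> f n x = 0) :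
  (forall i j (e : i + 1 = j) (x : A i), f j (dga_d A e x) = dga_d B e (f i x)) ->
  forall i j (e : i + 1 = j) (x : dgquo dS i),
  gquo_lift fS j (dga_d (dgquo dS) e x) = dga_d B e (gquo_lift fS i x).
Proof.
move=> fd i j e; elim/gpi_ind => x.
by rewrite [dga_d (dgquo dS) _ _](dgquo_dE dS) ![gquo_lift _ _ _]gquo_liftE fd.
Qed.

End LiftDifferential.

(** * The copies of A and U(A) inside the smash product *)

Section SmashProduct.
Context (k : fieldType) (A : dgPoisson k).
Local Notation U := (env (poi_dgLie A)).
Local Notation iota h := (@env_in k (poi_dgLie A) _ h).
Local Notation AU := (smash_alg A).

Definition smash_inl i (a : A i) : AU i := pure (addr0 i) a (gone U).
Definition smash_inr i (u : U i) : AU i := pure (add0r i) (gone A) u.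

Lemma smash_inl_lin i : linear (@smash_inl i).
Proof. exact: pure_linl. Qed.
Lemma smash_inr_lin i : linear (@smash_inr i).
Proof. exact: pure_linr. Qed.

Lemma smash_mul_inl i n m (e : i + n = m) (a : A i) (x : AU n) :
  gmul AU e (smash_inl a) x = lmulX e a x.
Proof. by rewrite (smash_gmulE e _ _ _ (add0r n) e) gh_one Lam1. Qed.

Lemma smash_mul_inr i n m (e : i + n = m) (u : U i) (x : AU n) :
  gmul AU e (smash_inr u) x = Lam e (env_comul _ i u) x.
Proof.
rewrite (smash_gmulE e _ _ _ e (add0r m)).
elim/tens_ind: (Lam _ _ _) => [j1 j2 p b h|c y z Hy Hz]; last by rewrite lmulX_linr Hy Hz.
by rewrite lmulX_pure; apply: pure_heq => //; apply: heq_mul1l.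
Qed.

Lemma smash_inlM i j n (e : i + j = n) (a : A i) (b : A j) :
  smash_inl (gmul A e a b) = gmul AU e (smash_inl a) (smash_inl b).
Proof. by rewrite smash_mul_inl lmulX_pure; apply: pure_heq => //; apply: heq_mul. Qed.

Lemma smash_inrM i j n (e : i + j = n) (u : U i) (v : U j) :
  smash_inr (gmul U e u v) = gmul AU e (smash_inr u) (smash_inr v).
Proof. by rewrite smash_mul_inr (Lam_one u e (add0r j) (add0r n) e v). Qed.

(** This factorization shows that the images of A and U(A) generate A # U(A). *)
Lemma smash_pureE i j n (e : i + j = n) (a : A i) (u : U j) :
  pure e a u = gmul AU e (smash_inl a) (smash_inr u).
Proof. by rewrite smash_mul_inl lmulX_pure; apply: pure_heq => //; rewrite /heq -heq_mul1r. Qed.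

(** The two terms come from the two summands of Delta(h) = h (x) 1 + 1 (x) h. *)
Lemma smash_mul_in_inl i j n (e : i + j = n) (e' : j + i = n) (h : A i) (b : A j) :
  gmul AU e (smash_inr (iota h)) (smash_inl b) =
  smash_inl (poi_br A e h b) + sgn k (i * j) *: pure e' b (iota h).
Proof.
rewrite smash_mul_inr (Lam_in e h (addr0 j) b (gone U) e (addr0 n) (addr0 i) e').
by rewrite gmul1r.
Qed.

(** * Universal property of the smash product *)

Section Lift.
Variables (B : gAlg k) (alpha : gHom A B) (beta : forall i, A i -> B i).
Hypothesis betaL : forall i, linear (@beta i).
Hypothesis beta_br : forall i j n (e : i + j = n) (e' : j + i = n) (g : A i) (h : A j),
  beta (poi_br A e g h) =
  gmul B e (beta g) (beta h) - sgn k (i * j) *: gmul B e' (beta h) (beta g).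
(** By [smash_mul_in_inl], this holds for any algebra map sending b # 1 to alpha(b) and 1 # h to
    beta(h). *)
Hypothesis alpha_br : forall i j n (e : i + j = n) (e' : j + i = n) (h : A i) (b : A j),
  alpha n (poi_br A e h b) =
  gmul B e (beta h) (alpha j b) - sgn k (i * j) *: gmul B e' (alpha j b) (beta h).

Let betaU : gHom U B := @env_lift k (poi_dgLie A) B beta betaL beta_br.

Definition smash_lift_fun n (x : AU n) : B n :=
  tens_lift (fun i j (e : i + j = n) (a : A i) (u : U j) =>
    gmul B e (alpha i a) (betaU j u)) x.

Lemma smash_lift_bilin n :
  bilin (fun i j (e : i + j = n) (a : A i) (u : U j) =>
    gmul B e (alpha i a) (betaU j u)).
Proof.
by split=> i j e u c v w; rewrite gh_lin (gmul_linl, gmul_linr).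
Qed.

Lemma smash_lift_lin n : linear (@smash_lift_fun n).
Proof. exact: tens_lift_lin (smash_lift_bilin n). Qed.

Lemma smash_lift_pure n i j (e : i + j = n) (a : A i) (u : U j) :
  smash_lift_fun (pure e a u) = gmul B e (alpha i a) (betaU j u).
Proof. by rewrite /smash_lift_fun tens_lift_pure //; apply: smash_lift_bilin. Qed.

Lemma smash_lift_lmulX i n m (e : i + n = m) (a : A i) (x : AU n) :
  smash_lift_fun (lmulX e a x) = gmul B e (alpha i a) (smash_lift_fun x).
Proof.
elim/tens_ind: x => [j1 j2 p b u|c x y Hx Hy]; last first.
  by rewrite lmulX_linr !smash_lift_lin Hx Hy gmul_linr.
by rewrite lmulX_pure !smash_lift_pure gh_mul (gmulA _ _ p e).
Qed.

(** The core of multiplicativity. Since D |-> [Lam] D turns products into composites, the claim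
    passes from factors to products in U(A), and only u = h in A calls for [alpha_br]. *)
Lemma smash_lift_Lam i (u : U i) : forall n m (e : i + n = m) (x : AU n),
  smash_lift_fun (Lam e (env_comul _ i u) x) = gmul B e (betaU i u) (smash_lift_fun x).
Proof.
move: i u; apply: env_ind.
- move=> n m e x; have nm : n = m by rewrite -e add0r.
  by destruct nm; rewrite !gh_one Lam1 gmul1l.
- move=> i h n m e x.
  elim/tens_ind: x => [j1 j2 p b w|c x y Hx Hy]; last first.
    by rewrite Lam_linx !smash_lift_lin Hx Hy gmul_linr.
  have E1 : i + j1 + j2 = m by rewrite -e -p addrA.
  have E2 : j1 + (i + j2) = m by rewrite -e -p addrCA.
  have E3 : j1 + i = i + j1 by rewrite addrC.
  rewrite (Lam_in e h p b w erefl E1 erefl E2) linD; last exact: smash_lift_lin.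
  rewrite linZ; last exact: smash_lift_lin.
  (* Expanding alpha({h,b}) yields a term that cancels the image of b # hw. *)
  rewrite !smash_lift_pure (alpha_br erefl E3) gmulBl gmulZl gh_mul.
  rewrite [betaU i _]env_lift_in (gmulA _ _ p e) (gmulA _ _ erefl E2).
  by rewrite subrK.
- move=> i j l f u v IHu IHv n m e x.
  have E : i + (j + n) = m by rewrite -e -f addrA.
  by rewrite !gh_mul (LamM _ _ erefl E) IHu IHv (gmulA _ _ erefl E).
- move=> i n m e x; rewrite !gh0 gmul0l (lin0 (Lam_linD _ _)).
  exact: lin0 (@smash_lift_lin _).
- move=> i c u v Hu Hv n m e x.
  by rewrite !gh_lin Lam_linD smash_lift_lin gmul_linl Hu Hv.
Qed.

(** As (a # u) y = a . [Lam] (Delta u) y, only [x] has to be split into pure tensors. *)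
Lemma smash_lift_mul i j n (e : i + j = n) (x : AU i) (y : AU j) :
  smash_lift_fun (gmul AU e x y) = gmul B e (smash_lift_fun x) (smash_lift_fun y).
Proof.
elim/tens_ind: x => [i1 i2 p a u|c x x' Hx Hx']; last first.
  by rewrite gmul_linl !smash_lift_lin Hx Hx' gmul_linl.
have E : i1 + (i2 + j) = n by rewrite -e -p addrA.
rewrite (smash_gmulE e _ _ _ erefl E) smash_lift_lmulX smash_lift_Lam.
by rewrite smash_lift_pure (gmulA _ _ erefl E).
Qed.

Lemma smash_lift_one : smash_lift_fun (gone AU) = gone B.
Proof. by rewrite [smash_lift_fun _]smash_lift_pure !gh_one gmul1l. Qed.

Definition smash_lift : gHom AU B :=
  GHom (@smash_lift_lin) smash_lift_mul smash_lift_one.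

Lemma smash_lift_inl i (a : A i) : smash_lift i (smash_inl a) = alpha i a.
Proof. by rewrite [smash_lift _ _]smash_lift_pure gh_one gmul1r. Qed.

Lemma smash_lift_in i (h : A i) : smash_lift i (smash_inr (iota h)) = beta h.
Proof.
by rewrite [smash_lift _ _]smash_lift_pure gh_one gmul1l [betaU _ _]env_lift_in.
Qed.

End Lift.
End SmashProduct.

(** * The map from the smash product quotient to A^e *)

Section Isomorphism.
Context (k : fieldType) (A : dgPoisson k).
Local Notation U := (env (poi_dgLie A)).
Local Notation iota h := (@env_in k (poi_dgLie A) _ h).
Local Notation AU := (smash_alg A).
Local Notation T := (tens_dgAlg (mh_diff A)).
Local Notation piE := (gpi (@AE_rel k A)).
Local Notation pie := (gpi (@Ae_rel k A)).

Definition Ae_m i (a : A i) : Ae A i := pie (mgen a).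
Definition Ae_h i (a : A i) : Ae A i := pie (hgen a).

Lemma Ae_m_lin i : linear (@Ae_m i).
Proof. by move=> c x y; rewrite /Ae_m mgen_lin gpi_lin. Qed.
Lemma Ae_h_lin i : linear (@Ae_h i).
Proof. by move=> c x y; rewrite /Ae_h hgen_lin gpi_lin. Qed.

Lemma Ae_m_mul i j n (e : i + j = n) (a : A i) (b : A j) :
  Ae_m (gmul A e a b) = gmul (Ae A) e (Ae_m a) (Ae_m b).
Proof. by rewrite gpiM; apply/gpi_eq/ideal_gen/Ae_mM. Qed.

Lemma Ae_h_mul i j n (e : i + j = n) (e' : j + i = n) (a : A i) (b : A j) :
  Ae_h (gmul A e a b) =
  gmul (Ae A) e (Ae_m a) (Ae_h b) + sgn k (i * j) *: gmul (Ae A) e' (Ae_m b) (Ae_h a).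
Proof.
(* Linearity is stated for c x + y, so the scaled summand is moved to the front and back. *)
rewrite !gpiM [RHS]addrC -gpi_lin [X in gpi _ X]addrC.
exact/gpi_eq/ideal_gen/Ae_hM.
Qed.

Lemma Ae_m_br i j n (e : i + j = n) (e' : j + i = n) (a : A i) (b : A j) :
  Ae_m (poi_br A e a b) =
  gmul (Ae A) e (Ae_h a) (Ae_m b) - sgn k (i * j) *: gmul (Ae A) e' (Ae_m b) (Ae_h a).
Proof.
rewrite !gpiM -(linZ (@gpi_lin _ _ _ _)) -(linB (@gpi_lin _ _ _ _)).
exact/gpi_eq/ideal_gen/Ae_mB.
Qed.

Lemma Ae_h_br i j n (e : i + j = n) (e' : j + i = n) (a : A i) (b : A j) :
  Ae_h (poi_br A e a b) =
  gmul (Ae A) e (Ae_h a) (Ae_h b) - sgn k (i * j) *: gmul (Ae A) e' (Ae_h b) (Ae_h a).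
Proof.
rewrite !gpiM -(linZ (@gpi_lin _ _ _ _)) -(linB (@gpi_lin _ _ _ _)).
exact/gpi_eq/ideal_gen/Ae_hB.
Qed.

Lemma Ae_m_one : Ae_m (gone A) = gone (Ae A).
Proof. exact/gpi_eq/ideal_gen/Ae_m1. Qed.

Definition Ae_m_hom : gHom A (Ae A) := @GHom k A (Ae A) Ae_m Ae_m_lin Ae_m_mul Ae_m_one.

(** The relations for h_{{a,b}} and m_{{a,b}} are exactly the two bracket hypotheses of the lift. *)
Definition smash_to_Ae : gHom AU (Ae A) :=
  smash_lift (alpha := Ae_m_hom) Ae_h_lin Ae_h_br Ae_m_br.

Lemma smash_to_Ae_rel n (x : AU n) : AE_rel x -> smash_to_Ae n x = 0.
Proof.
case=> {x n} i j n z e e' a b.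
(* The degree equation [z] is arbitrary, while [smash_inr] uses [add0r]. *)
have -> : pure z (gone A) (iota (gmul A e a b)) = smash_inr (iota (gmul A e a b)) :> AU n.
  exact: pure_heq.
rewrite !smash_pureE !ghB ghZ !gh_mul smash_lift_in !smash_lift_inl !smash_lift_in.
by rewrite (Ae_h_mul e e') -addrA -opprD subrr.
Qed.

(** A graded algebra map only: it serves as inverse to [Ae_to_AE], which carries the compatibility
    with d. *)
Definition AE_to_Ae : gHom (AE A) (Ae A) := gquo_lift smash_to_Ae_rel.

(** * The DG algebra map from A^e to A^E *)

Definition AE_inl i (a : A i) : AE A i := piE (smash_inl a).
Definition AE_inr i (u : U i) : AE A i := piE (smash_inr u).

Definition mh_to_AE i (x : mh_sp A i) : AE A i := AE_inl x.1 + AE_inr (iota x.2).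

Lemma AE_inl_lin i : linear (@AE_inl i).
Proof. by move=> c x y; rewrite /AE_inl smash_inl_lin gpi_lin. Qed.
Lemma AE_inr_lin i : linear (@AE_inr i).
Proof. by move=> c x y; rewrite /AE_inr smash_inr_lin gpi_lin. Qed.

Lemma mh_to_AE_lin i : linear (@mh_to_AE i).
Proof.
move=> c x y; rewrite /mh_to_AE /= AE_inl_lin env_in_lin AE_inr_lin scalerDr.
by rewrite addrACA.
Qed.

Definition T_to_AE : gHom T (AE A) := tlift mh_to_AE_lin.

Lemma T_to_AE_m i (a : A i) : T_to_AE i (mgen a) = AE_inl a.
Proof.
rewrite [LHS]tlift_gen /mh_to_AE /= (lin0 (@env_in_lin _ _ _)).
by rewrite (lin0 (@AE_inr_lin i)) addr0.
Qed.

Lemma T_to_AE_h i (a : A i) : T_to_AE i (hgen a) = AE_inr (iota a).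
Proof. by rewrite [LHS]tlift_gen /mh_to_AE /= (lin0 (@AE_inl_lin i)) add0r. Qed.

Lemma AE_inlM i j n (e : i + j = n) (a : A i) (b : A j) :
  AE_inl (gmul A e a b) = gmul (AE A) e (AE_inl a) (AE_inl b).
Proof. by rewrite /AE_inl smash_inlM -gpiM. Qed.
Lemma AE_inrM i j n (e : i + j = n) (u : U i) (v : U j) :
  AE_inr (gmul U e u v) = gmul (AE A) e (AE_inr u) (AE_inr v).
Proof. by rewrite /AE_inr smash_inrM -gpiM. Qed.
Lemma AE_pureE i j n (e : i + j = n) (a : A i) (u : U j) :
  piE (pure e a u : AU n) = gmul (AE A) e (AE_inl a) (AE_inr u).
Proof. by rewrite smash_pureE -gpiM. Qed.

(** The generators of I vanish in A^E. *)
Lemma AE_in_mul i j n (e : i + j = n) (e' : j + i = n) (a : A i) (b : A j) :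
  AE_inr (iota (gmul A e a b)) =
  gmul (AE A) e (AE_inl a) (AE_inr (iota b))
  + sgn k (i * j) *: gmul (AE A) e' (AE_inl b) (AE_inr (iota a)).
Proof.
rewrite -!AE_pureE -(linZ (@gpi_lin _ _ _ _)) -(linD (@gpi_lin _ _ _ _)).
by apply/gpi_eq; rewrite opprD addrA; apply/ideal_gen/AERel.
Qed.

Lemma AE_inl_br i j n (e : i + j = n) (e' : j + i = n) (a : A i) (b : A j) :
  AE_inl (poi_br A e a b) =
  gmul (AE A) e (AE_inr (iota a)) (AE_inl b)
  - sgn k (i * j) *: gmul (AE A) e' (AE_inl b) (AE_inr (iota a)).
Proof.
rewrite -AE_pureE gpiM (smash_mul_in_inl e e') (linD (@gpi_lin _ _ _ _)).
by rewrite (linZ (@gpi_lin _ _ _ _)) addrK.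
Qed.

(** The relations come, in order, from the product of A, the ideal I, the commutation of 1 # h with
    b # 1, the bracket relation in U(A), and the unit. *)
Lemma T_to_AE_rel n (x : T n) : Ae_rel x -> T_to_AE n x = 0.
Proof.
case=> {x n} [i j n e a b|i j n e e' a b|i j n e e' a b|i j n e e' a b|];
  rewrite ghB ?ghB ?ghD ?ghZ ?gh_mul ?gh_one ?T_to_AE_m ?T_to_AE_h.
- by rewrite AE_inlM subrr.
- by rewrite (AE_in_mul e e') subrr.
- by rewrite (AE_inl_br e e') subrr.
- rewrite [env_in _](env_in_br e e') (linB (@AE_inr_lin _)) (linZ (@AE_inr_lin _)).
  by rewrite !AE_inrM subrr.
- exact: subrr.
Qed.

Lemma T_to_AE_d i j (e : i + 1 = j) (x : T i) :
  T_to_AE j (dga_d T e x) = dga_d (AE A) e (T_to_AE i x).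
Proof.
move: i x j e; apply: tlift_d => i j e v; rewrite /mh_to_AE dga_dD.
rewrite ![dga_d (AE A) e _](dgquo_dE (@AE_rel_d k A)).
have e0 : 0 + 1 + i = j by rewrite -e addrC add0r.
rewrite (smash_dgE e (addr0 i) _ _ e erefl (addr0 j) e).
rewrite (smash_dgE e (add0r i) _ _ erefl e e0 (add0r j)).
(* The terms containing d(1) vanish, and the sign left in d(1 # h) is (-1)^0. *)
by rewrite !dga_d1 pure0r pure0l scaler0 addr0 add0r scale1r env_d_in.
Qed.

Definition Ae_to_AE : dgHom (Ae A) (AE A) :=
  @DGHom k (Ae A) (AE A) (gquo_lift T_to_AE_rel)
    (gquo_lift_d T_to_AE_rel T_to_AE_d).

Lemma Ae_to_AE_m i (a : A i) : Ae_to_AE i (Ae_m a) = AE_inl a.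
Proof. by rewrite [LHS]gquo_liftE T_to_AE_m. Qed.
Lemma Ae_to_AE_h i (a : A i) : Ae_to_AE i (Ae_h a) = AE_inr (iota a).
Proof. by rewrite [LHS]gquo_liftE T_to_AE_h. Qed.
Lemma AE_to_Ae_inl i (a : A i) : AE_to_Ae i (AE_inl a) = Ae_m a.
Proof. by rewrite [LHS]gquo_liftE [LHS]smash_lift_inl. Qed.
Lemma AE_to_Ae_in i (a : A i) : AE_to_Ae i (AE_inr (iota a)) = Ae_h a.
Proof. by rewrite [LHS]gquo_liftE [LHS]smash_lift_in. Qed.

(** * The two maps are mutually inverse *)

Lemma Ae_to_AEK i : cancel (Ae_to_AE i) (AE_to_Ae i).
Proof.
elim/gpi_ind; move: i; apply: tens_alg_ind.
- move=> i [a b].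
  (* A homogeneous generator is a pair, hence a sum m_a + h_b. *)
  have -> : tgen (V := mh_sp A) (a, b) = mgen a + hgen b :> T i.
    rewrite /mgen /hgen -(linD (@tgen_lin _ _ _)); congr tgen.
    by congr pair; rewrite /= ?addr0 ?add0r.
  rewrite (linD (@gpi_lin _ _ _ _)) !ghD [Ae_to_AE i _]Ae_to_AE_m AE_to_Ae_inl.
  by rewrite [Ae_to_AE i _]Ae_to_AE_h AE_to_Ae_in.
- by rewrite -[gpi _ _]/(gone (Ae A)) !gh_one.
- by move=> i j n e x y Hx Hy; rewrite -gpiM !gh_mul Hx Hy.
- by move=> n; rewrite (lin0 (@gpi_lin _ _ _ _)) !gh0.
- by move=> n c x y Hx Hy; rewrite gpi_lin !ghD !ghZ Hx Hy.
Qed.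

Lemma AE_to_AeK_inr i (u : U i) : Ae_to_AE i (AE_to_Ae i (AE_inr u)) = AE_inr u.
Proof.
move: i u; apply: env_ind.
(* Both sides are the class of 1 # 1, with different proofs of 0 + 0 = 0. *)
- by rewrite [AE_inr _](_ : _ = gone (AE A)) ?gh_one //; congr gpi; apply: pure_heq.
- by move=> i h; rewrite AE_to_Ae_in Ae_to_AE_h.
- by move=> i j n e u v Hu Hv; rewrite AE_inrM !gh_mul Hu Hv.
- by move=> n; rewrite (lin0 (@AE_inr_lin n)) !gh0.
- by move=> n c u v Hu Hv; rewrite AE_inr_lin !ghD !ghZ Hu Hv.
Qed.

(** Writing a # u as (a # 1)(1 # u) leaves the two factors to be checked separately. *)
Lemma AE_to_AeK i : cancel (AE_to_Ae i) (Ae_to_AE i).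
Proof.
elim/gpi_ind; elim/tens_ind=> [i1 i2 e a u|c x y Hx Hy]; last first.
  by rewrite gpi_lin !ghD !ghZ Hx Hy.
by rewrite AE_pureE !gh_mul AE_to_AeK_inr AE_to_Ae_inl Ae_to_AE_m.
Qed.

End Isomorphism.

Theorem propositionA (k : fieldType) (A : dgPoisson k) :
  dg_isomorphic (Ae A) (AE A).
Proof.
exists (Ae_to_AE A) => n.
exact: Bijective (@Ae_to_AEK k A n) (@AE_to_AeK k A n).
Qed.
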